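(* Let $X$ be a complex Banach space, $1\le p<\infty$, and let $\{U(t,\tau)\}_{t\ge\tau}$ be an exponentially bounded evolution family on $X$. The following are equivalent: (i) $\{U(t,\tau)\}_{t\ge\tau}$ is exponentially stable; (ii) $\mathbb G$ is a bounded operator on $L^p(\mathbb R_+,X)$; (iii) $\mathbb G$ is a bounded operator on $C_0(\mathbb R_+,X)$.
   Context: $\mathbb R_+=[0,\infty)$. $C_0(\mathbb R_+,X)$ is the space of continuous $X$-valued functions on $\mathbb R_+$ vanishing at infinity, with the sup norm. An evolution family on $X$ is a family $\{U(t,\tau)\}_{t\ge\tau\ge0}$ of bounded linear operators on $X$ such that $U(t,\tau)=U(t,s)U(s,\tau)$ and $U(t,t)=I$ for $t\ge s\ge\tau$, and for each $x\in X$ the map $(t,\tau)\mapsto U(t,\tau)x$ is continuous for $t\ge\tau$. It is exponentially bounded if there are $M\ge1$, $\omega\in\mathbb R$ with $\|U(t,\tau)\|\le Me^{\omega(t-\tau)}$ for all $t\ge\tau$; it is (uniformly) exponentially stable if this holds with some $\omega<0$. For $f\in L^1_{loc}(\mathbb R_+,X)$ put $$(\mathbb Gf)(t)=\int_0^tU(t,\tau)f(\tau)\,d\tau,\qquad t\ge0.$$ ''$\mathbb G$ is a bounded operator on a space $\mathcal F$'' means that $\mathbb Gf\in\mathcal F$ for every $f\in\mathcal F$ and $f\mapsto\mathbb Gf$ is bounded on $\mathcal F$. *)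

(* Defs.v *)
From mathcomp Require Import all_boot all_order all_algebra.
From mathcomp Require Import all_classical all_reals all_analysis.
From mathcomp Require Import complex.

Set Implicit Arguments.
Unset Strict Implicit.
Unset Printing Implicit Defensive.

Import Order.TTheory GRing.Theory Num.Theory.
Import numFieldNormedType.Exports.

Local Open Scope classical_set_scope.
Local Open Scope ring_scope.
Local Open Scope complex_scope.

(* The norm of a normed module over R[i] takes its values in R[i] (on the
   nonnegative real axis); rnorm is the same number as an element of R. *)
Definition rnorm (R : realType) (X : normedModType R[i]) (x : X) : R :=
  complex.Re `|x|.

Section bochner.
Context d (T : measurableType d) (R : realType) (X : normedModType R[i]).
Variable mu : {measure set T -> \bar R}.
Implicit Types (D : set T) (s : {fimfun T >-> X}) (f : T -> X).

(* {fimfun T >-> X} only provides the finiteness of the range. *)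
Definition measurable_simple s := forall x : X, measurable (s @^-1` [set x]).

(* mu-strong measurability: almost everywhere limit of simple functions *)
Definition strongly_measurable D f :=
  exists s_ : nat -> {fimfun T >-> X},
    (forall n, measurable_simple (s_ n)) /\
    {ae mu, forall t, D t -> s_ n t @[n --> \oo] --> f t}.

Definition integrable_simple D s :=
  measurable_simple s /\
  forall x : X, x != 0 -> (mu (D `&` s @^-1` [set x]) < +oo)%E.

(* fine maps a possible measure +oo of the fibre over 0 to 0, and the
   corresponding term is then 0 *: 0. *)
Definition simple_integral D s : X :=
  \sum_(x \in range s) (fine (mu (D `&` s @^-1` [set x])))%:C *: x.

Definition is_bochner_integral D f (v : X) :=
  exists s_ : nat -> {fimfun T >-> X},
    [/\ forall n, integrable_simple D (s_ n),
        {ae mu, forall t, D t -> s_ n t @[n --> \oo] --> f t},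
        (\int[mu]_(t in D) (rnorm (f t - s_ n t))%:E)%E @[n --> \oo] --> 0%E
      & simple_integral D (s_ n) @[n --> \oo] --> v].

(* The value is 0 when f is not Bochner integrable on D. *)
Definition bochner_integral D f : X := xget 0 (is_bochner_integral D f).

End bochner.

Section function_spaces.
Context (R : realType) (X : normedModType R[i]).
Implicit Types f : R -> X.

(* Functions on [0, +oo[ are represented by functions on R, whose values on
   ]-oo, 0[ are ignored. *)
Definition Rplus : set R := `[0, +oo[%classic.

Definition Lp_norm (p : R) f : \bar R :=
  'N[lebesgue_measure]_(p%:E)[(fun t => (rnorm (f t))%:E) \_ Rplus]%E.

(* f represents an element of L^p(R_+, X); elements are not identified
   almost everywhere. *)
Definition Lp_space (p : R) : set (R -> X) :=
  [set f | strongly_measurable lebesgue_measure Rplus f /\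
           (Lp_norm p f < +oo)%E].

Definition sup_norm f : \bar R :=
  ereal_sup [set (rnorm (f t))%:E | t in Rplus].

Definition C0_space : set (R -> X) :=
  [set f | {within Rplus, continuous f} /\ f t @[t --> +oo] --> (0 : X)].

Definition bounded_operator_on (F : set (R -> X)) (N : (R -> X) -> \bar R)
    (G : (R -> X) -> (R -> X)) :=
  (forall f, F f -> F (G f)) /\
  exists C : R, forall f, F f -> (N (G f) <= C%:E * N f)%E.

End function_spaces.

Arguments Lp_space {R} X p.
Arguments C0_space {R} X.

Section evolution_family.
Context (R : realType) (X : normedModType R[i]).

Definition opnorm (A : X -> X) : \bar R :=
  ereal_sup [set (rnorm (A x))%:E | x in [set x : X | rnorm x <= 1]].

(* Only the values U t tau with 0 <= tau <= t are meaningful. *)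
Implicit Type U : R -> R -> {linear X -> X}.

Record evolution_family U : Prop := EvolutionFamily {
  evol_bounded : forall t tau, 0 <= tau <= t -> (opnorm (U t tau) < +oo)%E ;
  evol_comp : forall t s tau, 0 <= tau -> tau <= s -> s <= t ->
    forall x, U t tau x = U t s (U s tau x) ;
  evol_id : forall t, 0 <= t -> forall x, U t t x = x ;
  evol_continuous : forall x : X,
    {within [set z : R * R | 0 <= z.2 <= z.1],
      continuous (fun z : R * R => U z.1 z.2 x)} }.

Definition exp_bound U (M omega : R) :=
  forall t tau, 0 <= tau <= t ->
    (opnorm (U t tau) <= (M * expR (omega * (t - tau)))%:E)%E.

Definition exponentially_bounded U :=
  exists M omega : R, 1 <= M /\ exp_bound U M omega.

Definition exponentially_stable U :=
  exists M omega : R, [/\ 1 <= M, omega < 0 & exp_bound U M omega].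

(* For U exponentially bounded and f locally integrable on [0, +oo[ (in
   particular f in L^p or C_0) the integrand is Bochner integrable on [0, t],
   so the default value of bochner_integral is not used. *)
Definition opG U (f : R -> X) (t : R) : X :=
  bochner_integral (@lebesgue_measure R) `[0, t]%classic
    (fun tau => U t tau (f tau)).

End evolution_family.

(* Main.v *)
Require Import Defs.
From HB Require Import structures.
From mathcomp Require Import all_boot all_order all_algebra.
From mathcomp Require Import finmap.
From mathcomp Require Import all_classical all_reals all_analysis.
From mathcomp Require Import measurable_realfun simple_functions measurable_fun_approximation.
From mathcomp Require Import complex.
From mathcomp Require Import ring lra.

(* If U is exponentially stable, |Gf(t)| is at most the convolution of |f| with
   M exp(-a t), and G is bounded on C_0 directly and on L^p by Tonelli. For the
   latter, Hoelder's inequality is replaced by the pointwise bound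
   y <= l + l^(1-p) y^p, optimized over l after integrating against the kernel.

   Conversely, G is tested on f(tau) = phi(tau) U(tau,s)x with phi supported in
   [s, s+T]: the cocycle identity makes the integrand constant up to phi, so
   that Gf(t) = (int phi) U(t,s)x for t >= s+T. On C_0, phi is a trapezoid of
   length T and T |U(t,s)x| is bounded by C sup |U(tau,s)x|. On L^p, phi is the
   indicator of [s, s+1] and the norm of Gf over [t-T, t] gives a bound on
   T^(1/p) |U(t,s)x|; a long indicator would give nothing for p = 1. Either
   bound, used first with T = 1 and then with T large, makes U(t,s) a
   contraction once t - s is large. The equivalence of (ii) and (iii) goes
   through (i). *)

Set Implicit Arguments.
Unset Strict Implicit.
Unset Printing Implicit Defensive.
Import Order.TTheory GRing.Theory Num.Theory.
Import numFieldNormedType.Exports.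
Import HBNNSimple.
Local Open Scope classical_set_scope.
Local Open Scope ring_scope.
Local Open Scope complex_scope.

(** * Real-valued norms *)

(** Two obstacles shape the integration theory. [bochner_integral] is a choice among all admissible
    limits, so no value is known before existence and uniqueness are proved. And
    [strongly_measurable] leaves a null set on which the function is arbitrary, so that its norm
    need not be measurable; functions are therefore first replaced by everywhere limits of simple
    functions ([simple_limit]), with which each element of L^p agrees almost everywhere on R_+. Even
    for constant f, tau -> U(t,tau) f(tau) is not simple, hence tau is rounded to a grid along with
    f.

    Continuity of Gf is proved once: it is half of membership in C_0 and the source of strong
    measurability in L^p.

    In the converse the power of T decides. An indicator of length T has L^p norm T^(1/p), and Gf
    equals T U(t,s)x later on; on a window of unit length the gain is only T^(1-1/p), which is 1 for
    p = 1. A unit indicator seen through a window of length T gains T^(1/p) for every p. Both gains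
    come with a bound K for U over times up to T, which under the growth bound alone could outgrow
    any power of T; so U must be uniformly bounded before T is taken large. *)

Section rnorm.
Context (R : realType) (X : normedModType R[i]).
Implicit Types x y z : X.

Lemma normrE_rnorm x : `|x| = (rnorm x)%:C.
Proof.
have := normr_ge0 x; rewrite /rnorm; case: `|x| => a b /=.
by rewrite lecE /= => /andP[/eqP -> _].
Qed.

Lemma rnorm_ge0 x : 0 <= rnorm x.
Proof. by rewrite -ler0c -normrE_rnorm. Qed.

Lemma rnorm0 : rnorm (0 : X) = 0.
Proof. by rewrite /rnorm normr0. Qed.

Lemma rnorm_eq0 x : (rnorm x == 0) = (x == 0).
Proof.
by rewrite -(normr_eq0 x) normrE_rnorm -[0 in RHS]/(0%:C) (inj_eq (@complexI R)).
Qed.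

Lemma rnormD x y : rnorm (x + y) <= rnorm x + rnorm y.
Proof. by rewrite -lecR rmorphD /= -!normrE_rnorm ler_normD. Qed.

Lemma rnormN x : rnorm (- x) = rnorm x.
Proof. by rewrite /rnorm normrN. Qed.

Lemma rdistC x y : rnorm (x - y) = rnorm (y - x).
Proof. by rewrite -rnormN opprB. Qed.

Lemma rnormB x y : rnorm (x - y) <= rnorm x + rnorm y.
Proof. by rewrite (le_trans (rnormD _ _))// rnormN. Qed.

Lemma rdistD z x y : rnorm (x - y) <= rnorm (x - z) + rnorm (z - y).
Proof. by rewrite (le_trans _ (rnormD _ _))// addrA subrK. Qed.

Lemma rnormZ (a : R) x : rnorm (a%:C *: x) = `|a| * rnorm x.
Proof.
apply: complexI.
by rewrite -normrE_rnorm normrZ normrE_rnorm rmorphM /= normc_def /= expr0n addr0 sqrtr_sqr.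
Qed.

Lemma ler_dist_rnorm x y : `|rnorm x - rnorm y| <= rnorm (x - y).
Proof.
rewrite ler_distl; apply/andP; split.
  by rewrite lerBlDr -{1}(subrK x y) (le_trans (rnormD _ _))// addrC rdistC.
by rewrite -{1}(subrK y x) (le_trans (rnormD _ _))// addrC.
Qed.

Lemma rnorm_sum (I : Type) (r : seq I) (P : pred I) (F : I -> X) :
  rnorm (\sum_(i <- r | P i) F i) <= \sum_(i <- r | P i) rnorm (F i).
Proof.
elim/big_ind2 : _ => [|x a y b xa yb|//]; first by rewrite rnorm0.
by rewrite (le_trans (rnormD _ _))// lerD.
Qed.

(** The order of [R[i]] only compares numbers with equal imaginary parts, so every epsilon met in
    the topology of [X] is real. This is what allows convergence in [X] to be tested with
    [rnorm]. *)
Lemma posc_real (e : R[i]) : 0 < e -> exists2 r : R, 0 < r & e = r%:C.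
Proof.
case: e => a b; rewrite ltcE /= => /andP[/eqP b0 a0]; exists a => //.
by rewrite b0.
Qed.

Lemma cvg_rnormP (T : Type) (F : set_system T) (FF : Filter F) (f : T -> X) (l : X) :
  f @ F --> l <-> rnorm (f t - l) @[t --> F] --> (0 : R).
Proof.
split=> [/cvgr_distC_lt fl|/cvgr0Pnorm_lt fl].
  apply/cvgr0Pnorm_lt => e e0.
  have /fl : 0 < e%:C by rewrite ltcR.
  by apply: filterS => t; rewrite normrE_rnorm ltcR ger0_norm// rnorm_ge0.
apply/cvgrPdistC_lt => e /posc_real[r r0 ->].
move/fl: r0; apply: filterS => t.
by rewrite normrE_rnorm ltcR ger0_norm// rnorm_ge0.
Qed.

Lemma cvg_rnorm (T : Type) (F : set_system T) (FF : Filter F) (f : T -> X) (l : X) :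
  f @ F --> l -> rnorm (f t) @[t --> F] --> rnorm l.
Proof.
move=> /cvg_rnormP/cvgr0Pnorm_lt fl; apply/cvgrPdistC_lt => e /fl.
by apply: filterS => t; apply: le_lt_trans; rewrite (ger0_norm (rnorm_ge0 _)) ler_dist_rnorm.
Qed.

Lemma cvg_rnorm_le (T : Type) (F : set_system T) (FF : Filter F) (f : T -> X)
    (l : X) (g : T -> R) :
  (\forall t \near F, rnorm (f t - l) <= g t) -> g @ F --> (0 : R) -> f @ F --> l.
Proof.
move=> fg g0; apply/cvg_rnormP; apply: (@squeeze_cvgr _ _ _ _ (cst 0) g) => //.
  by apply: filterS fg => t ->; rewrite rnorm_ge0.
exact: cvg_cst.
Qed.

End rnorm.

(** * Simple functions and their integrals *)

Section simple.
Context d (T : measurableType d).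

(** The codomain is an arbitrary type so that pairs, booleans and natural numbers are covered;
    differences, restrictions and grid functions then all come from [msimple_pair] and
    [msimple_comp]. *)
Definition msimple (Z : Type) (h : T -> Z) :=
  finite_set (range h) /\ forall z, measurable (h @^-1` [set z]).

Lemma msimple_preimage (Z : Type) (h : T -> Z) (A : set Z) :
  msimple h -> measurable (h @^-1` A).
Proof.
move=> [fh mh].
rewrite (_ : _ @^-1` _ = \bigcup_(z in range h `&` A) (h @^-1` [set z])).
  by apply: fin_bigcup_measurable => //; exact: finite_setIl.
apply/seteqP; split => t /=.
  by move=> At; exists (h t) => //; split => //; exists t.
by move=> [z [_ Az] /= ->].
Qed.

Lemma msimple_comp (Z Y : Type) (h : T -> Z) (phi : Z -> Y) :
  msimple h -> msimple (phi \o h).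
Proof.
move=> sh; split; last by move=> y; rewrite comp_preimage; exact: msimple_preimage.
by rewrite -(image_comp h phi); apply: finite_image; case: sh.
Qed.

Lemma msimple_pair (Z Y : Type) (h : T -> Z) (k : T -> Y) :
  msimple h -> msimple k -> msimple (fun t => (h t, k t)).
Proof.
move=> [fh mh] [fk mk]; split.
  apply: (sub_finite_set _ (finite_setX fh fk)) => _ [t _ <-] /=.
  by split; exists t.
move=> [z y]; rewrite (_ : _ @^-1` _ = h @^-1` [set z] `&` k @^-1` [set y]).
  exact: measurableI.
by apply/seteqP; split => t /= => [[-> ->]//|[-> ->]].
Qed.

Lemma msimple_cst (Z : Type) (z : Z) : msimple (fun _ : T => z).
Proof.
split; first by apply: (sub_finite_set _ (finite_set1 z)) => _ [t _ <-].
by move=> y; rewrite preimage_cst; case: ifPn.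
Qed.

Lemma msimple_patch (Z : Type) (D : set T) (k h : T -> Z) :
  measurable D -> msimple k -> msimple h -> msimple (patch k D h).
Proof.
move=> mD sk sh.
have sD : msimple (fun t => t \in D).
  split; first exact: finite_finset.
  move=> b; rewrite (_ : _ @^-1` _ = if b then D else ~` D).
    by case: b => //; exact: measurableC.
  apply/seteqP; split=> t /=; first by move=> <-; case: ifPn => [/set_mem|/negP tD /mem_set].
  by case: b; [move/mem_set | move=> /= nD; apply/negbTE; rewrite notin_setE].
have := msimple_comp (fun bzz => if bzz.1 then bzz.2.1 else bzz.2.2)
  (msimple_pair sD (msimple_pair sh sk)).
exact.
Qed.

Definition fimfun_of (Z : Type) (h : T -> Z) (fh : finite_set (range h)) :
  {fimfun T >-> Z} := HB.pack h (FiniteImage.Build _ _ h fh).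

End simple.

Section simple_integral.
Context d (T : measurableType d) (R : realType) (X : normedModType R[i]).
Variables (mu : {measure set T -> \bar R}) (D : set T).
Hypotheses (mD : measurable D) (Doo : (mu D < +oo)%E).

(* simple_integral for a function that is not packaged as a fimfun. *)
Definition sint (s : T -> X) : X :=
  \sum_(x \in range s) (fine (mu (D `&` s @^-1` [set x])))%:C *: x.

Lemma measureI_fin (A : set T) : measurable A -> mu (D `&` A) \is a fin_num.
Proof.
move=> mA; rewrite ge0_fin_numE//; apply: le_lt_trans Doo.
by apply: le_measure; [exact/mem_set/measurableI|exact/mem_set|exact: subIsetl].
Qed.

(** The fibre of [phi \o h] over x is the disjoint union of the fibres of [h] over those z with
    [phi z = x]. Applied to the pair of two simple functions, it writes both integrals over one
    common partition, which gives additivity. *)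
Lemma sint_comp (Z : choiceType) (h : T -> Z) (phi : Z -> X) : msimple h ->
  sint (phi \o h) =
  \sum_(z \in range h) (fine (mu (D `&` h @^-1` [set z])))%:C *: phi z.
Proof.
move=> sh; have [fh mh] := sh; have [fp mp] := msimple_comp phi sh.
pose m z := fine (mu (D `&` h @^-1` [set z])).
have mE x : fine (mu (D `&` (phi \o h) @^-1` [set x])) =
    \sum_(z <- fset_set (range h)) (if phi z == x then m z else 0).
  rewrite (_ : _ `&` _ = \bigcup_(z in range h)
      (D `&` h @^-1` [set z] `&` [set t | phi z = x])); last first.
    apply/seteqP; split => t /=.
      by move=> [Dt <-]; exists (h t); [exists t|split].
    by move=> [z [u _ <-]] [[Dt /= ->]] xE; split.
  have mF z : measurable (D `&` h @^-1` [set z] `&` [set t | phi z = x]).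
    apply: measurableI; first exact: measurableI.
    have [e|e] := pselect (phi z = x).
      by rewrite (_ : [set _ | _] = setT)//; apply/seteqP; split.
    by rewrite (_ : [set _ | _] = set0)//; apply/seteqP; split.
  rewrite measure_fin_bigcup//; last first.
    apply/trivIsetP => i j _ _ ij; apply/seteqP; split => // t /=.
    by move=> [[[_ hi] _] [[_ hj] _]]; move: ij; rewrite -hi -hj eqxx.
  rewrite fsbig_finite//= (eq_bigr (fun z => (if phi z == x then m z else 0)%:E)).
    by rewrite sumEFin.
  move=> z _; case: eqP => e.
    rewrite (_ : [set _ | _] = setT); last by apply/seteqP; split.
    by rewrite setIT fineK// measureI_fin.
  rewrite (_ : [set _ | _] = set0); last by apply/seteqP; split.
  by rewrite setI0 measure0.
rewrite /sint !fsbig_finite//=.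
under eq_bigr do rewrite mE rmorph_sum scaler_suml.
rewrite exchange_big /=; apply: eq_big_seq => z.
rewrite in_fset_set// inE => -[t _ hz].
rewrite (bigD1_seq (phi z)) ?fset_uniq//=; last first.
  by rewrite in_fset_set// inE; exists t => //=; rewrite hz.
by rewrite eqxx big1 ?addr0// => x xz; rewrite eq_sym (negbTE xz) scale0r.
Qed.

Lemma sintB (s s' : T -> X) : msimple s -> msimple s' ->
  sint (s \- s') = sint s - sint s'.
Proof.
move=> ss ss'; have sh := msimple_pair ss ss'.
have := sint_comp (fun z => z.1 - z.2) sh; rewrite /comp/= => ->.
have := sint_comp (fun z => z.1) sh; rewrite /comp/= => ->.
have := sint_comp (fun z => z.2) sh; rewrite /comp/= => ->.
rewrite !fsbig_finite/=; [|by case: sh..].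
by rewrite -sumrB; apply: eq_bigr => z _; rewrite scalerBr.
Qed.

Lemma integral_rnorm_simple (s : T -> X) : msimple s ->
  (\int[mu]_(t in D) (rnorm (s t))%:E =
   \sum_(x <- fset_set (range s)) (fine (mu (D `&` s @^-1` [set x])) * rnorm x)%:E)%E.
Proof.
move=> [fs ms].
under eq_integral => t _.
  have -> : ((rnorm (s t))%:E =
      \sum_(x <- fset_set (range s)) (rnorm x * \1_(s @^-1` [set x]) t)%:E)%E.
    rewrite sumEFin (bigD1_seq (s t)) ?fset_uniq//=; last first.
      by rewrite in_fset_set// inE; exists t.
    rewrite big1 ?addr0.
      by rewrite indicE mem_set// mulr1.
    by move=> x xs; rewrite indicE memNset ?mulr0//= => /esym; exact/eqP.
  over.
rewrite ge0_integral_sum//; last 2 first.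
- move=> x; apply/measurable_EFinP; apply: measurable_funM => //.
- by move=> x t _; rewrite lee_fin mulr_ge0// rnorm_ge0.
apply: eq_bigr => x _.
rewrite (integralZl_indic mD (fun=> s @^-1` [set x]))//; last first.
  by move=> /lt_geF; rewrite rnorm_ge0.
by rewrite integral_indic// setIC EFinM fineK ?measureI_fin// muleC.
Qed.

Lemma rnorm_sint_le (s : T -> X) : msimple s ->
  ((rnorm (sint s))%:E <= \int[mu]_(t in D) (rnorm (s t))%:E)%E.
Proof.
move=> ss; rewrite integral_rnorm_simple// sumEFin lee_fin /sint fsbig_finite/=.
  apply: (le_trans (rnorm_sum _ _ _)); apply: ler_sum => x _.
  by rewrite rnormZ ger0_norm// fine_ge0.
by case: ss.
Qed.

Lemma integral_rnorm_simple_fin (s : T -> X) : msimple s ->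
  (\int[mu]_(t in D) (rnorm (s t))%:E < +oo)%E.
Proof. by move=> ss; rewrite integral_rnorm_simple// sumEFin ltry. Qed.

End simple_integral.

Lemma sint_patch d (T : measurableType d) (R : realType) (X : normedModType R[i])
  (mu : {measure set T -> \bar R}) (D D' : set T) (s : T -> X) :
  D' `<=` D -> sint mu D (patch (fun=> 0) D' s) = sint mu D' s.
Proof.
move=> DD; rewrite /sint.
(* The two ranges differ, so both sums are extended to all of [X], where empty fibres contribute 0.
   Afterwards only the fibres over 0 can differ, and these carry the factor [x = 0]. *)
have wid A (f : T -> X) : \sum_(x \in range f) (fine (mu (A `&` f @^-1` [set x])))%:C *: x =
    \sum_(x \in setT) (fine (mu (A `&` f @^-1` [set x])))%:C *: x.
  apply: fsbig_widen => // x [_ /= nx]; rewrite preimage10//.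
  by rewrite setI0 measure0 scale0r.
rewrite !wid; apply: eq_fsbigr => x _.
have [->|x0] := eqVneq x 0; first by rewrite !scaler0.
congr ((fine (mu _))%:C *: _); apply/seteqP; split => t /=.
  rewrite /patch; case: ifPn => [/set_mem D't [_ <-]//|_ [_ e]].
  by move: x0; rewrite -e eqxx.
by move=> [D't <-]; split; [exact: DD|rewrite /patch mem_set].
Qed.

(** * Bochner integral *)

(* No measurability is required: the integral of a nonnegative function is a
   supremum over the simple functions below it, and such a simple function can
   be multiplied by the indicator of a set of full measure. *)
Lemma ge0_ae_le_integral_nomeas d (T : measurableType d) (R : realType)
    (mu : {measure set T -> \bar R}) (D : set T) (f g : T -> \bar R) :
  (forall t, D t -> 0 <= f t)%E -> (forall t, D t -> 0 <= g t)%E ->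
  {ae mu, forall t, D t -> (f t <= g t)%E} ->
  (\int[mu]_(t in D) f t <= \int[mu]_(t in D) g t)%E.
Proof.
move=> f0 g0 [N [mN N0 fgN]].
rewrite ge0_integralE// [leRHS]ge0_integralE//.
apply: ge_ereal_sup => _ [h /= hf <-].
have mC : measurable (~` N) by exact: measurableC.
rewrite -integralT_nnsfun (ge0_negligible_integral mN)//; last 2 first.
- exact/measurable_EFinP.
- by move=> t _; rewrite lee_fin; exact: fun_ge0.
rewrite setTD integral_nnsfun// mrestrict.
apply: ereal_sup_ubound; exists (proj_nnsfun h mC) => //= t.
rewrite /= patchE /mindic indicE in_setC.
have g0t : (0 <= (if t \in D then g t else point))%E.
  by case: ifPn => // /set_mem; exact: g0.
have [tN|tN] := boolP (t \in N).
  by rewrite mulr0.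
rewrite mulr1.
apply: (le_trans (hf t)); rewrite patchE; case: ifPn => // /set_mem Dt.
apply: contrapT => nfg; move: tN; rewrite notin_setE; apply; apply: fgN => /=.
by move/(_ Dt).
Qed.

Lemma ge0_ae_eq_integral_nomeas d (T : measurableType d) (R : realType)
    (mu : {measure set T -> \bar R}) (D : set T) (f g : T -> \bar R) :
  (forall t, D t -> 0 <= f t)%E -> (forall t, D t -> 0 <= g t)%E ->
  {ae mu, forall t, D t -> f t = g t} ->
  (\int[mu]_(t in D) f t = \int[mu]_(t in D) g t)%E.
Proof.
move=> f0 g0 fg; apply/eqP; rewrite eq_le; apply/andP; split.
  by apply: ge0_ae_le_integral_nomeas => //; apply: filterS fg => t + Dt => ->.
by apply: ge0_ae_le_integral_nomeas => //; apply: filterS fg => t + Dt => ->.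
Qed.

(** * Everywhere limits of simple functions *)

Section simple_limits.
Context d (T : measurableType d) (R : realType) (X : normedModType R[i]).
Implicit Types (D : set T) (f g : T -> X).

(* Unlike for strongly_measurable, the convergence holds at every point of D. *)
Definition simple_limit D f := exists s_ : nat -> T -> X,
  (forall n, msimple (s_ n)) /\ forall t, D t -> s_ n t @[n --> \oo] --> f t.

Lemma msimple_measurable_rnorm D (s : T -> X) : msimple s ->
  measurable_fun D (fun t => rnorm (s t)).
Proof.
move=> ss mD Y mY; apply: measurableI => //.
exact: (msimple_preimage Y (msimple_comp (@rnorm R X) ss)).
Qed.

Lemma simple_limit_measurable_rnorm D f : simple_limit D f ->
  measurable_fun D (fun t => rnorm (f t)).
Proof.
move=> [s_ [ss sf]].
apply: (@measurable_fun_cvg _ _ _ D (fun n t => rnorm (s_ n t))).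
  by move=> n; exact: msimple_measurable_rnorm.
by move=> t Dt; apply: cvg_rnorm; exact: sf.
Qed.

Lemma msimple_simple_limit D (s : T -> X) : msimple s -> simple_limit D s.
Proof. by move=> ss; exists (fun=> s); split => // t _; exact: cvg_cst. Qed.

Lemma simple_limitB D f g : simple_limit D f -> simple_limit D g ->
  simple_limit D (f \- g).
Proof.
move=> [s_ [ss sf]] [s'_ [ss' sg]]; exists (fun n => s_ n \- s'_ n); split.
  move=> n; exact: (msimple_comp (fun z => z.1 - z.2) (msimple_pair (ss n) (ss' n))).
by move=> t Dt; apply: cvgB; [exact: sf|exact: sg].
Qed.

Lemma simple_limit_sub D' D f : D' `<=` D -> simple_limit D f -> simple_limit D' f.
Proof. by move=> DD [s_ [ss sf]]; exists s_; split => // t /DD; exact: sf. Qed.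

Lemma simple_limit_patch D D' f : measurable D' -> simple_limit (D `&` D') f ->
  simple_limit D (patch (fun=> 0) D' f).
Proof.
move=> mD [s_ [ss sf]]; exists (fun n => patch (fun=> 0) D' (s_ n)); split.
  by move=> n; apply: msimple_patch => //; exact: msimple_cst.
move=> t Dt; rewrite /patch; case: ifPn => [/set_mem D't|_]; first exact: sf.
exact: cvg_cst.
Qed.

Variable mu : {measure set T -> \bar R}.

Lemma simple_limit_strongly_measurable D f :
  simple_limit D f -> strongly_measurable mu D f.
Proof.
move=> [s_ [ss sf]]; exists (fun n => fimfun_of (proj1 (ss n))); split.
  by move=> n x; case: (ss n).
exact: aeW.
Qed.

(** The representative is [f] set to 0 on a measurable null set that contains all points without
    convergence. *)
Lemma strongly_measurable_simple_limit D f : strongly_measurable mu D f ->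
  exists2 g, simple_limit D g & {ae mu, forall t, D t -> f t = g t}.
Proof.
move=> [s_ [ss [N [mN N0 sN]]]]; exists (patch (fun=> 0) (~` N) f).
  apply: simple_limit_patch; first exact: measurableC.
  exists s_; split; first by move=> n; split; [exact: fimfunP|exact: ss].
  by move=> t [Dt nNt]; apply: contrapT => h; apply: nNt; apply: sN => /= /(_ Dt).
exists N; split => // t /=; apply: contra_notP => nNt Dt.
by rewrite /patch mem_set.
Qed.

End simple_limits.

Section bochner_integral.
Context d (T : measurableType d) (R : realType) (X : normedModType R[i]).
Variable mu : {measure set T -> \bar R}.
Implicit Types (D : set T) (f g : T -> X).

Lemma eq_is_bochner_integral D f g v : {ae mu, forall t, D t -> f t = g t} ->
  is_bochner_integral mu D f v -> is_bochner_integral mu D g v.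
Proof.
move=> fg [s_ [si sf s0 sv]]; exists s_; split => //.
  by apply: filterS2 fg sf => t fg sf Dt; rewrite -fg//; exact: sf.
rewrite (_ : (fun _ => _) =
  (fun n => (\int[mu]_(t in D) (rnorm (f t - s_ n t))%:E)%E))//.
apply/funext => n; apply: ge0_ae_eq_integral_nomeas.
- by move=> t _; rewrite lee_fin rnorm_ge0.
- by move=> t _; rewrite lee_fin rnorm_ge0.
- by apply: filterS fg => t + Dt => ->.
Qed.

Lemma eq_bochner_integral D f g : {ae mu, forall t, D t -> f t = g t} ->
  bochner_integral mu D f = bochner_integral mu D g.
Proof.
move=> fg; congr xget; apply/seteqP; split => v; apply: eq_is_bochner_integral => //.
by apply: filterS fg => t + Dt => ->.
Qed.

Variable D : set T.
Hypotheses (mD : measurable D) (Doo : (mu D < +oo)%E).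

Let measurable_EFin_rnorm f : simple_limit D f ->
  measurable_fun D (fun t => (rnorm (f t))%:E).
Proof. by move=> /simple_limit_measurable_rnorm ?; exact/measurable_EFinP. Qed.

Lemma integral_rnormB_le f g : simple_limit D f -> simple_limit D g ->
  (\int[mu]_(t in D) (rnorm (f t - g t))%:E <=
   \int[mu]_(t in D) (rnorm (f t))%:E + \int[mu]_(t in D) (rnorm (g t))%:E)%E.
Proof.
move=> sf sg; rewrite -ge0_integralD//; last 4 first.
- by move=> t _; rewrite lee_fin rnorm_ge0.
- exact: measurable_EFin_rnorm.
- by move=> t _; rewrite lee_fin rnorm_ge0.
- exact: measurable_EFin_rnorm.
apply: ge0_le_integral => //.
- by move=> t _; rewrite lee_fin rnorm_ge0.
- exact/(measurable_EFin_rnorm (simple_limitB sf sg)).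
- by apply: emeasurable_funD; exact: measurable_EFin_rnorm.
- by move=> t _; rewrite -EFinD lee_fin rnormB.
Qed.

(** For the approximating s_n the triangle inequality is a finite sum, and |s_n| <= |f| + |f - s_n|;
    the integral of the last term tends to 0. *)
Lemma is_bochner_integral_rnorm_le f v : simple_limit D f ->
  is_bochner_integral mu D f v ->
  ((rnorm v)%:E <= \int[mu]_(t in D) (rnorm (f t))%:E)%E.
Proof.
move=> sf [s_ [si _ s0 sv]].
have ss n : msimple (s_ n) by split => //; case: (si n).
apply: (@lee_cvg_to _ \oo _ R (fun n => (rnorm (simple_integral mu D (s_ n)))%:E)
  (fun n => \int[mu]_(t in D) (rnorm (f t))%:E +
     \int[mu]_(t in D) (rnorm (f t - s_ n t))%:E)%E).
- by apply: cvg_EFin; [exact: nearW|exact: cvg_rnorm].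
- rewrite -[X in _ --> X]adde0; apply: cvgeD => //; last exact: cvg_cst.
  by rewrite fin_num_adde_defl.
- apply: nearW => n; apply: (le_trans (rnorm_sint_le mD Doo (ss n))).
  apply: le_trans (integral_rnormB_le sf (simple_limitB sf (msimple_simple_limit D (ss n)))).
  rewrite le_eqVlt; apply/orP; left; apply/eqP.
  by apply: eq_integral => t _; rewrite opprB addrC subrK.
Qed.

Lemma is_bochner_integralB f g v w : simple_limit D f -> simple_limit D g ->
  is_bochner_integral mu D f v -> is_bochner_integral mu D g w ->
  is_bochner_integral mu D (f \- g) (v - w).
Proof.
move=> sf sg [s_ [si sfc s0 sv]] [r_ [ri rgc r0 rw]].
have ss n : msimple (s_ n) by split => //; case: (si n).
have sr n : msimple (r_ n) by split => //; case: (ri n).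
have sd n : msimple (s_ n \- r_ n).
  exact: (msimple_comp (fun z => z.1 - z.2) (msimple_pair (ss n) (sr n))).
exists (fun n => fimfun_of (proj1 (sd n))); split.
- move=> n; split; first by move=> x; case: (sd n).
  move=> x _; apply: le_lt_trans Doo; apply: le_measure; last exact: subIsetl.
    by apply/mem_set/measurableI => //; case: (sd n).
  exact/mem_set.
- by apply: filterS2 sfc rgc => t sfc rgc Dt; apply: cvgB; [exact: sfc|exact: rgc].
- apply: (@squeeze_cvge _ _ _ _ (cst 0%E) _ (fun n =>
    \int[mu]_(t in D) (rnorm (f t - s_ n t))%:E +
     \int[mu]_(t in D) (rnorm (g t - r_ n t))%:E)%E).
  + apply: nearW => n; apply/andP; split.
      by apply: integral_ge0 => t _; rewrite lee_fin rnorm_ge0.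
    apply: le_trans (integral_rnormB_le (simple_limitB sf (msimple_simple_limit D (ss n)))
       (simple_limitB sg (msimple_simple_limit D (sr n)))).
    rewrite le_eqVlt; apply/orP; left; apply/eqP; apply: eq_integral => t _ /=.
    by congr (rnorm _)%:E; rewrite !opprB addrACA [RHS]addrACA [- g t + _]addrC.
  + exact: cvg_cst.
  + by rewrite -[X in _ --> X]adde0; apply: cvgeD.
- rewrite (_ : (fun _ => _) = (fun n => sint mu D (s_ n) - sint mu D (r_ n))).
    exact: cvgB.
  by apply/funext => n; rewrite -sintB.
Qed.

(** By additivity v - w is an integral of f - f = 0, so its norm is at most 0. Hence the choice made
    by [xget] is forced. *)
Lemma is_bochner_integral_unique f v w : simple_limit D f ->
  is_bochner_integral mu D f v -> is_bochner_integral mu D f w -> v = w.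
Proof.
move=> sf fv fw; have := is_bochner_integralB sf sf fv fw.
move/(is_bochner_integral_rnorm_le (simple_limitB sf sf)).
under eq_integral do rewrite /= subrr rnorm0.
rewrite integral0 lee_fin => h; apply/eqP; rewrite -subr_eq0 -rnorm_eq0.
by rewrite eq_le h rnorm_ge0.
Qed.

Lemma bochner_integral_eq f v : simple_limit D f ->
  is_bochner_integral mu D f v -> bochner_integral mu D f = v.
Proof.
move=> sf fv; apply: (is_bochner_integral_unique sf _ fv).
by apply: xgetPex; exists v.
Qed.

(** Serves to move integrals over [[0, t]] with varying t to one common interval, where they can be
    subtracted. *)
Lemma is_bochner_integral_patch D' f v : D' `<=` D -> measurable D' ->
  is_bochner_integral mu D' f v ->
  is_bochner_integral mu D (patch (fun=> 0) D' f) v.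
Proof.
move=> DD mD' [s_ [si sf s0 sv]].
have ss n : msimple (s_ n) by split => //; case: (si n).
have sp n : msimple (patch (fun=> 0) D' (s_ n)).
  by apply: msimple_patch => //; exact: msimple_cst.
exists (fun n => fimfun_of (proj1 (sp n))); split.
- move=> n; split; first by move=> x; case: (sp n).
  move=> x _; apply: le_lt_trans Doo; apply: le_measure; last exact: subIsetl.
    by apply/mem_set/measurableI => //; case: (sp n).
  exact/mem_set.
- apply: filterS sf => t sf Dt /=; rewrite /patch; case: ifPn => [/set_mem|_]; first exact: sf.
  exact: cvg_cst.
- rewrite (_ : (fun _ => _) =
    (fun n => (\int[mu]_(t in D') (rnorm (f t - s_ n t))%:E)%E))//.
  apply/funext => n; rewrite -[in RHS](setIidr DD) integral_mkcondr.
  apply: eq_integral => t _ /=; rewrite patchE /patch.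
  by case: ifPn => // _; rewrite subrr rnorm0.
- rewrite (_ : (fun _ => _) = (fun n => sint mu D' (s_ n)))//.
  by apply/funext => n; rewrite -(sint_patch _ _ DD).
Qed.

End bochner_integral.

(** * Existence of the Bochner integral on sets of finite measure *)

Section bochner_existence.
Context d (T : measurableType d) (R : realType) (X : completeNormedModType R[i]).
Variables (mu : {measure set T -> \bar R}) (D : set T).
Hypotheses (mD : measurable D) (Doo : (mu D < +oo)%E).

Lemma cauchy_rnorm_cvg (u : nat -> X) (e_ : nat -> R) :
  (forall n m, rnorm (u n - u m) <= e_ n + e_ m) ->
  e_ @ \oo --> (0 : R) -> cvgn u.
Proof.
move=> ue e0; apply: cauchy_cvg; apply: cauchy_exP => e /posc_real[r r0 ->].
have /cvgr0Pnorm_lt e0' := e0.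
have [N _ HN] : \forall n \near \oo, `|e_ n| < r / 2 by apply: e0'; rewrite divr_gt0.
exists (u N); exists N => // n /= Nn.
rewrite -ball_normE /ball_ /= normrE_rnorm ltcR.
apply: (le_lt_trans (ue _ _)); rewrite (splitr r).
have h1 := HN N (leqnn _); have h2 := HN n Nn.
by apply: ltrD; [apply: le_lt_trans h1|apply: le_lt_trans h2]; exact: ler_norm.
Qed.

Lemma bochner_integralP (f : T -> X) : simple_limit D f ->
  (\int[mu]_(t in D) (rnorm (f t))%:E < +oo)%E ->
  is_bochner_integral mu D f (bochner_integral mu D f).
Proof.
move=> sf foo; have [s_ [ss scv]] := sf.
have mf := simple_limit_measurable_rnorm sf.
have intf : mu.-integrable D (fun t => (rnorm (f t))%:E).
  apply/integrableP; split; first exact/measurable_EFinP.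
  by under eq_integral do rewrite gee0_abs ?lee_fin ?rnorm_ge0//.
(* The given simple functions may be large, so [s_ n] is cut to 0 outside [A n]; then |f - r_n| <=
   3|f| and dominated convergence applies. Since 2 > 1, the cut is eventually inactive wherever
   [f t != 0]; where [f t = 0] it forces the value 0, the correct limit. *)
pose A n := D `&` [set t | rnorm (s_ n t) <= 2 * rnorm (f t)].
have mA n : measurable (A n).
  apply: measurable_fun_le => //; first exact: msimple_measurable_rnorm.
  exact: measurable_funM.
pose r_ n := patch (fun=> 0) (A n) (s_ n).
have sr n : msimple (r_ n) by apply: msimple_patch => //; exact: msimple_cst.
have r2 n t : rnorm (r_ n t) <= 2 * rnorm (f t).
  rewrite /r_ /patch; case: ifPn => [/set_mem[]//|_].
  by rewrite rnorm0 mulr_ge0 ?rnorm_ge0.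
have rcv t : D t -> r_ n t @[n --> \oo] --> f t.
  move=> Dt; have [f0|f0] := eqVneq (f t) 0.
    rewrite (_ : (fun _ => _) = cst 0); first by rewrite f0; exact: cvg_cst.
    apply/funext => n; apply/eqP; rewrite -rnorm_eq0 eq_le rnorm_ge0 andbT.
    by have := r2 n t; rewrite f0 rnorm0 mulr0.
  apply: cvg_trans (scv t Dt); apply: near_eq_cvg.
  have /cvgr_le : rnorm (s_ n t) @[n --> \oo] --> rnorm (f t).
    by apply: cvg_rnorm; exact: scv.
  have fpos : 0 < rnorm (f t) by rewrite lt_def rnorm_eq0 f0 rnorm_ge0.
  move=> /(_ (2 * rnorm (f t))) -/(_ _)/wrap[|]; first by rewrite ltr_pMl// ltr1n.
  by apply: filterS => n rn; rewrite /r_ /patch mem_set.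
have srn n : simple_limit D (f \- r_ n) by exact/simple_limitB/msimple_simple_limit.
have r0 : (\int[mu]_(t in D) (rnorm (f t - r_ n t))%:E)%E @[n --> \oo] --> 0%E.
  have := @dominated_convergence _ T R mu D mD (fun n t => (rnorm (f t - r_ n t))%:E)
    (cst 0%E) (fun t => 3%:E * (rnorm (f t))%:E)%E.
  case.
  - by move=> n; apply/measurable_EFinP/(simple_limit_measurable_rnorm (srn n)).
  - exact: measurable_cst.
  - apply: aeW => t Dt; apply: cvg_EFin; first exact: nearW.
    rewrite -(@rnorm0 _ X) -(subrr (f t)); apply: cvg_rnorm.
    by apply: cvgB; [exact: cvg_cst|exact: rcv].
  - exact: integrableZl.
  - apply: aeW => t n Dt /=; rewrite lee_fin ger0_norm ?rnorm_ge0//.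
    by rewrite (le_trans (rnormB _ _))//; have := r2 n t; lra.
  by move=> _ _; rewrite integral0.
have Ifin n : (\int[mu]_(t in D) (rnorm (f t - r_ n t))%:E)%E \is a fin_num.
  rewrite ge0_fin_numE; last by apply: integral_ge0 => t _; rewrite lee_fin rnorm_ge0.
   apply: (le_lt_trans (integral_rnormB_le mu mD sf (msimple_simple_limit D (sr n)))).
  by rewrite lte_add_pinfty// integral_rnorm_simple_fin.
(* The simple integrals are Cauchy: two of them differ by at most the sum of the distances of r_n
   and r_m from f in L^1. Completeness of [X] enters here. *)
have /cvg_ex[v rv] : cvgn (fun n => sint mu D (r_ n)).
  apply: (@cauchy_rnorm_cvg _ (fun n => fine (\int[mu]_(t in D) (rnorm (f t - r_ n t))%:E)%E)).
    move=> n m; rewrite -lee_fin EFinD !fineK//.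
    rewrite rdistC -sintB//.
    have srm : msimple (r_ m \- r_ n).
      exact: (msimple_comp (fun z => z.1 - z.2) (msimple_pair (sr m) (sr n))).
    apply: (le_trans (rnorm_sint_le mD Doo srm)).
    apply: le_trans (integral_rnormB_le mu mD (srn n) (srn m)).
    rewrite le_eqVlt; apply/orP; left; apply/eqP; apply: eq_integral => t _ /=.
    by congr (rnorm _)%:E; rewrite [RHS]addrC opprB addrA subrK.
  by apply: fine_cvg.
suff : is_bochner_integral mu D f v by move=> h; apply: xgetPex; exists v.
exists (fun n => fimfun_of (proj1 (sr n))); split => //.
- move=> n; split; first by move=> x; case: (sr n).
  move=> x _; apply: le_lt_trans Doo; apply: le_measure;
    [apply/mem_set/measurableI => //; exact: (proj2 (sr n))|exact/mem_set|exact: subIsetl].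
- by apply: aeW => t Dt; exact: rcv.
Qed.

End bochner_existence.

(** * The operator G *)

Section discretization.
Context (R : realType).

(* For t >= 0, the largest multiple of 1/(n+1) below min t n. *)
Definition grid (n : nat) (t : R) : R :=
  (Num.truncn (Num.min (Num.max t 0) n%:R * n.+1%:R))%:R / n.+1%:R.

Let clamp n (t : R) : R := Num.min (Num.max t 0) n%:R.

Let clamp_ge0 n t : 0 <= clamp n t.
Proof. by rewrite /clamp le_min ler0n andbT le_max lexx orbT. Qed.

Let clampM_ge0 n t : 0 <= clamp n t * n.+1%:R.
Proof. by rewrite mulr_ge0 ?clamp_ge0. Qed.

Lemma grid_ge0 n t : 0 <= grid n t.
Proof. by rewrite divr_ge0. Qed.

Lemma grid_le n t : 0 <= t -> grid n t <= t.
Proof.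
move=> t0; rewrite ler_pdivrMr ?ltr0n//.
have /andP[h _] := truncn_itv (clampM_ge0 n t); apply: (le_trans h).
by rewrite ler_pM2r ?ltr0n// /clamp (max_idPl t0) ge_min lexx.
Qed.

Lemma msimple_grid n : msimple (grid n).
Proof.
apply: (msimple_comp (fun k : nat => k%:R / n.+1%:R : R)).
have mc : measurable_fun setT (fun t => clamp n t * n.+1%:R).
  by apply: measurable_funM => //; apply: measurable_minr => //; exact: measurable_maxr.
split.
  apply: (sub_finite_set _ (finite_II (n * n.+1).+1)) => _ [t _ <-] /=.
  have /andP[h _] := truncn_itv (clampM_ge0 n t).
  rewrite ltnS -(ler_nat R); apply: (le_trans h).
  by rewrite natrM ler_pM2r ?ltr0n// ge_min lexx orbT.
move=> k; rewrite (_ : _ @^-1` _ =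
    (fun t => clamp n t * n.+1%:R) @^-1` `[k%:R, k.+1%:R[%classic).
  by rewrite -[X in measurable X]setTI; exact: mc.
apply/seteqP; split=> t /=.
  by move=> <-; rewrite in_itv/=; exact: (truncn_itv (clampM_ge0 n t)).
by rewrite in_itv/= => kt; exact: truncn_def.
Qed.

Lemma cvg_grid t : 0 <= t -> grid n t @[n --> \oo] --> t.
Proof.
move=> t0; apply/cvgrPdist_le => e e0; near=> n.
have tn : t <= n%:R by near: n; exact: nbhs_infty_ger.
have en : n.+1%:R^-1 <= e.
  near: n; have /cvgr0Pnorm_le := @cvg_harmonic R.
  move=> /(_ _ e0); apply: filterS => n.
  by rewrite /harmonic/= ger0_norm ?invr_ge0.
apply: le_trans en.
have cE : clamp n t = t by rewrite /clamp (max_idPl t0) (min_idPl tn).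
have := truncn_itv (clampM_ge0 n t); rewrite -/(clamp n t) cE => /andP[h1 h2].
rewrite ger0_norm ?subr_ge0 ?grid_le// lerBlDr /grid -/(clamp n t) cE.
rewrite -[X in _ <= X + _]mul1r -mulrDl ler_pdivlMr ?ltr0n//.
by rewrite nat1r ltW.
Unshelve. all: by end_near. Qed.

End discretization.

Lemma opnorm_leP (R : realType) (X : normedModType R[i]) (A : {linear X -> X}) (c : R) :
  0 <= c ->
  (opnorm A <= c%:E)%E <-> forall x, rnorm (A x) <= c * rnorm x.
Proof.
move=> c0; split => [Ac x|Ac]; last first.
  apply: ge_ereal_sup => _ [x /= x1 <-]; rewrite lee_fin (le_trans (Ac x))//.
  by rewrite -[leRHS]mulr1 ler_wpM2l.
have [->|x0] := eqVneq x 0; first by rewrite linear0 !rnorm0 mulr0.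
have xpos : 0 < rnorm x by rewrite lt_def rnorm_eq0 x0 rnorm_ge0.
have : rnorm (A ((rnorm x)^-1%:C *: x)) <= c.
  rewrite -lee_fin; apply: le_trans Ac; apply: ereal_sup_ubound.
  exists ((rnorm x)^-1%:C *: x) => //=.
  by rewrite rnormZ ger0_norm ?invr_ge0 ?rnorm_ge0// mulVf ?gt_eqF.
rewrite linearZ /= rnormZ ger0_norm ?invr_ge0 ?rnorm_ge0//.
by rewrite mulrC ler_pdivrMr.
Qed.

Lemma cvg_within_comp (T : topologicalType) (I : Type) (S : topologicalType) (A : set T)
    (f : T -> S) (F : set_system I) (FF : Filter F) (u : I -> T) (a : T) :
  {within A, continuous f} -> A a -> (\forall i \near F, A (u i)) ->
  u @ F --> a -> f (u i) @[i --> F] --> f a.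
Proof.
move=> /subspace_continuousP cf Aa uA ua.
apply: (@cvg_comp _ _ _ u f F (within A (nbhs a))); last exact: cf.
move=> P; rewrite /within /= => aP; have := ua _ aP.
by move: uA; apply: filterS2 => i Ai /(_ Ai).
Qed.

Lemma continuous_simple_limit (R : realType) (X : normedModType R[i]) (f : R -> X) :
  {within @Rplus R, continuous f} -> simple_limit (@Rplus R) f.
Proof.
move=> cf; exists (fun n => f \o grid n); split.
  by move=> n; apply: msimple_comp; exact: msimple_grid.
move=> t; rewrite /Rplus /= in_itv/= andbT => t0.
apply: (cvg_within_comp _ cf).
- by rewrite /Rplus /= in_itv/= andbT.
- by apply: nearW => n; rewrite /Rplus /= in_itv/= andbT grid_ge0.
- exact: cvg_grid.
Qed.

(** * Growth bounds and measurability of the integrand *)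

Section evolution.
Context (R : realType) (X : normedModType R[i]) (U : R -> R -> {linear X -> X}).
Hypothesis hU : evolution_family U.

Definition evol_growth (M w : R) := forall t s x, 0 <= s -> s <= t ->
  rnorm (U t s x) <= M * expR (w * (t - s)) * rnorm x.

Lemma exp_boundP (M w : R) : 1 <= M -> exp_bound U M w <-> evol_growth M w.
Proof.
move=> M1; have M0 : 0 <= M by rewrite (le_trans _ M1).
split=> [h t s x s0 st|h t s /andP[s0 st]].
  by apply: (opnorm_leP _ _).1; rewrite ?mulr_ge0 ?expR_ge0//; apply: h; rewrite s0.
by apply/opnorm_leP; [rewrite mulr_ge0 ?expR_ge0|move=> x; exact: h].
Qed.

(** The absolute value makes the exponential increasing in the length of time, whatever the sign of
    [w], so one constant serves all times up to [T]. *)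
Lemma evol_growth_loc (M w : R) : 1 <= M -> evol_growth M w ->
  forall T t s x, 0 <= s -> s <= t -> t - s <= T ->
  rnorm (U t s x) <= M * expR (`|w| * T) * rnorm x.
Proof.
move=> M1 h T t s x s0 st tT; have M0 : 0 <= M by rewrite (le_trans _ M1).
apply: (le_trans (h _ _ _ s0 st)); rewrite ler_wpM2r ?rnorm_ge0// ler_wpM2l//.
rewrite ler_expR (@le_trans _ _ (`|w| * (t - s)))//.
  by rewrite ler_wpM2r ?subr_ge0 ?ler_norm.
by rewrite ler_wpM2l.
Qed.

Lemma evol_cvg (I : Type) (F : set_system I) (FF : Filter F) (a b : I -> R) (t s : R)
    (x : X) : 0 <= s -> s <= t ->
  (\forall i \near F, 0 <= b i <= a i) ->
  a @ F --> t -> b @ F --> s -> U (a i) (b i) x @[i --> F] --> U t s x.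
Proof.
move=> s0 st ba at_ bs.
apply: (@cvg_within_comp _ _ _ _ _ F FF (fun i => (a i, b i)) (t, s)
  (@evol_continuous _ _ _ hU x)) => //=; first by rewrite s0.
exact: (cvg_pair at_ bs).
Qed.

(** With both tau and f discretized, the integrand is a function of a pair of simple functions. The
    local growth bound controls the replacement of s_n by f, uniformly in the rounded time; strong
    continuity handles the rounding. Rounding downwards keeps the pair of times in the domain of
    [U]. *)
Lemma simple_limit_evol (M w t : R) (f : R -> X) : 1 <= M -> evol_growth M w ->
  0 <= t -> simple_limit `[0, t]%classic f ->
  simple_limit `[0, t]%classic (fun tau => U t tau (f tau)).
Proof.
move=> M1 hM t0 [s_ [ss sf]].
exists (fun n tau => U t (grid n tau) (s_ n tau)); split.
  move=> n.
  exact: (msimple_comp (fun z => U t z.1 z.2) (msimple_pair (msimple_grid R n) (ss n))).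
move=> tau /[dup] Dtau; rewrite /= in_itv/= => /andP[tau0 taut].
pose K := M * expR (`|w| * t).
apply: (@cvg_rnorm_le _ _ _ _ _ _ _ (fun n => K * rnorm (s_ n tau - f tau) +
   rnorm (U t (grid n tau) (f tau) - U t tau (f tau)))).
  apply: nearW => n; have gn := grid_le n tau0.
  apply: (le_trans (rdistD (U t (grid n tau) (f tau)) _ _)); rewrite lerD2r -linearB.
  apply: evol_growth_loc => //; first exact: grid_ge0.
    exact: le_trans gn taut.
  by rewrite lerBlDr lerDl grid_ge0.
rewrite -[X in _ --> X]addr0; apply: cvgD.
  rewrite -[X in _ --> X](mulr0 K); apply: cvgM; first exact: cvg_cst.
  by apply/cvg_rnormP; exact: sf.
apply/cvg_rnormP; apply: evol_cvg => //; last 2 first.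
- exact: cvg_cst.
- exact: cvg_grid.
by apply: nearW => n; rewrite grid_ge0 (le_trans (grid_le n tau0)).
Qed.

End evolution.

Lemma itv0_fin (R : realType) (t : R) :
  (@lebesgue_measure R `[0%R, t]%classic < +oo)%E.
Proof. by rewrite lebesgue_measure_itv/=; case: ifP => // _; rewrite EFinN sube0 ltry. Qed.

(** * Pointwise estimate and continuity of Gf *)

Section opG.
Context (R : realType) (X : completeNormedModType R[i]) (U : R -> R -> {linear X -> X}).
Hypothesis hU : evolution_family U.
Variables (M w : R).
Hypotheses (M1 : 1 <= M) (hM : evol_growth U M w).
Local Notation mu := (@lebesgue_measure R).

Definition loc_integrable (f : R -> X) := simple_limit (@Rplus R) f /\
  forall T, 0 <= T -> (\int[mu]_(t in `[0%R, T]) (rnorm (f t))%:E < +oo)%E.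

Variable f : R -> X.
Hypothesis lf : loc_integrable f.

Let itvS (t : R) : `[0%R, t]%classic `<=` @Rplus R.
Proof. by move=> s; rewrite /Rplus /= !in_itv/= andbT => /andP[]. Qed.

Let sf (t : R) : simple_limit `[0, t]%classic f.
Proof. exact: (simple_limit_sub (@itvS t) (proj1 lf)). Qed.

Let mf (t : R) : measurable_fun `[0, t]%classic (fun s => (rnorm (f s))%:E).
Proof. exact/measurable_EFinP/simple_limit_measurable_rnorm/sf. Qed.

Let sUf (t : R) : 0 <= t -> simple_limit `[0, t]%classic (fun tau => U t tau (f tau)).
Proof. by move=> t0; exact: (simple_limit_evol hU M1 hM). Qed.

Lemma integral_rnorm_evol_le (t : R) : 0 <= t ->
  (\int[mu]_(tau in `[0%R, t]) (rnorm (U t tau (f tau)))%:E <=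
   \int[mu]_(tau in `[0%R, t]) (M * expR (w * (t - tau)) * rnorm (f tau))%:E)%E.
Proof.
move=> t0; apply: ge0_le_integral => //.
- by move=> tau _; rewrite lee_fin rnorm_ge0.
- exact/measurable_EFinP/simple_limit_measurable_rnorm/sUf.
- apply/measurable_EFinP; apply: measurable_funM; last exact/simple_limit_measurable_rnorm/sf.
  apply: measurable_funM => //; apply: measurableT_comp => //.
  by apply: measurable_funM => //; apply: measurable_funB.
- by move=> tau; rewrite /= in_itv/= lee_fin => /andP[tau0 taut]; exact: hM.
Qed.

Lemma integral_rnorm_evol_fin (t : R) : 0 <= t ->
  (\int[mu]_(tau in `[0%R, t]) (rnorm (U t tau (f tau)))%:E < +oo)%E.
Proof.
move=> t0; pose K := M * expR (`|w| * t).
have K0 : 0 <= K by rewrite mulr_ge0 ?expR_ge0// (le_trans _ M1).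
have KE : (\int[mu]_(s in `[0%R, t]) (K * rnorm (f s))%:E =
    K%:E * \int[mu]_(s in `[0%R, t]) (rnorm (f s))%:E)%E.
  rewrite -ge0_integralZl//; first exact: (@mf t).
  by move=> s _; rewrite lee_fin rnorm_ge0.
apply: (@le_lt_trans _ _ (\int[mu]_(s in `[0%R, t]) (K * rnorm (f s))%:E)%E).
  apply: ge0_le_integral => //.
  - by move=> s _; rewrite lee_fin rnorm_ge0.
  - exact/measurable_EFinP/simple_limit_measurable_rnorm/sUf.
  - apply/measurable_EFinP; apply: measurable_funM => //.
    exact/simple_limit_measurable_rnorm/sf.
  - move=> s; rewrite /= in_itv/= lee_fin => /andP[s0 st].
    by apply: evol_growth_loc => //; rewrite lerBlDr lerDl.
rewrite KE.
by rewrite lte_mul_pinfty// ?(proj2 lf).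
Qed.

Lemma opG_is_bochner_integral (t : R) : 0 <= t ->
  is_bochner_integral mu `[0, t]%classic (fun tau => U t tau (f tau)) (opG U f t).
Proof.
move=> t0; apply: bochner_integralP => //; first exact: itv0_fin.
  exact: sUf.
exact: integral_rnorm_evol_fin.
Qed.

Lemma opG_rnorm_le (t : R) : 0 <= t ->
  ((rnorm (opG U f t))%:E <=
   \int[mu]_(tau in `[0%R, t]) (M * expR (w * (t - tau)) * rnorm (f tau))%:E)%E.
Proof.
move=> t0; apply: le_trans (integral_rnorm_evol_le t0).
apply: is_bochner_integral_rnorm_le => //; [exact: itv0_fin|exact: sUf|].
exact: opG_is_bochner_integral.
Qed.

Let P (t : R) := patch (fun=> 0) `[0, t]%classic (fun tau => U t tau (f tau)).

Let sP (T t : R) : 0 <= t -> simple_limit `[0, T]%classic (P t).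
Proof.
move=> t0; apply: simple_limit_patch => //.
by apply: (simple_limit_sub _ (sUf t0)); exact: subIsetr.
Qed.

Lemma opGB_rnorm_le (T t t' : R) : 0 <= t <= T -> 0 <= t' <= T ->
  ((rnorm (opG U f t - opG U f t'))%:E <=
   \int[mu]_(tau in `[0%R, T]) (rnorm (P t tau - P t' tau))%:E)%E.
Proof.
move=> /andP[t0 tT] /andP[t'0 t'T].
have ext s : 0 <= s -> s <= T -> is_bochner_integral mu `[0, T]%classic (P s) (opG U f s).
  move=> s0 sT; apply: is_bochner_integral_patch => //; first exact: itv0_fin.
    by move=> r; rewrite /= !in_itv/= => /andP[-> /le_trans]; apply.
  exact: opG_is_bochner_integral.
apply: is_bochner_integral_rnorm_le => //; first exact: itv0_fin.
  by apply: simple_limitB; exact: sP.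
apply: is_bochner_integralB; [by []|exact: itv0_fin|exact: sP|exact: sP|exact: ext|exact: ext].
Qed.

(** Dominated convergence for the integrands extended by 0 to a fixed interval [[0, T]]. For tau <
    t0 they converge by strong continuity of U, for tau > t0 they are eventually 0, and the jump at
    tau = t0 is a null set. *)
Lemma opG_continuous : {within @Rplus R, continuous (opG U f)}.
Proof.
apply/subspace_continuousP => t0; rewrite /Rplus /= in_itv/= andbT => t00.
(* Clamping to [[0, T]] gives every real t an integrand with the same integrable bound, so [F] is
   finite everywhere; near t0 within [Rplus] the clamp is the identity. *)
pose T := t0 + 1; pose c (t : R) := Num.min (Num.max t 0) T.
have T0 : 0 <= T by rewrite addr_ge0.
have c0 t : 0 <= c t by rewrite /c le_min le_max lexx orbT.
have cT t : c t <= T by rewrite /c ge_min lexx orbT.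
have ct t : 0 <= t -> t <= T -> c t = t.
  by move=> h1 h2; rewrite /c (max_idPl h1) (min_idPl h2).
have t0T : t0 <= T by rewrite lerDl.
have ccont : continuous c.
  move=> t; apply: (@continuous_min R R (fun t => Num.max t 0) (cst T)); last exact: cst_continuous.
  by apply: (@continuous_max R R id (cst 0)); [exact: cvg_id|exact: cst_continuous].
pose F t := fine (\int[mu]_(tau in `[0%R, T]) (rnorm (P (c t) tau - P t0 tau))%:E)%E.
pose K := M * expR (`|w| * T).
have K0 : 0 <= K by rewrite mulr_ge0 ?expR_ge0// (le_trans _ M1).
have PK s tau : 0 <= s -> s <= T -> rnorm (P s tau) <= K * rnorm (f tau).
  move=> s0 sT; rewrite /P /patch; case: ifPn => [/set_mem|_]; last first.
    by rewrite rnorm0 mulr_ge0// rnorm_ge0.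
  rewrite /= in_itv/= => /andP[tau0 taus]; apply: evol_growth_loc => //.
  by rewrite lerBlDr (le_trans sT)// lerDl.
have PB t tau : rnorm (P (c t) tau - P t0 tau) <= 2 * K * rnorm (f tau).
  apply: (le_trans (rnormB _ _)).
  by have := PK _ tau (c0 t) (cT t); have := PK _ tau t00 t0T; lra.
have sPB t : simple_limit `[0, T]%classic (P (c t) \- P t0) by apply: simple_limitB; exact: sP.
have mPB t : measurable_fun `[0%R, T]%classic (fun tau => (rnorm (P (c t) tau - P t0 tau))%:E).
  apply/measurable_EFinP; have h := simple_limit_measurable_rnorm (sPB t); exact: h.
have intK : mu.-integrable `[0, T] (fun tau => (2 * K * rnorm (f tau))%:E).
  apply: (@integrableZl _ _ R mu `[0%R, t0 + 1]%classic (measurable_itv _) (2 * K)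
    (fun tau => (rnorm (f tau))%:E)).
  apply/integrableP; split; first exact: mf.
  under eq_integral do rewrite gee0_abs ?lee_fin ?rnorm_ge0//.
  exact: (proj2 lf).
have Ffin t : (\int[mu]_(tau in `[0%R, T]) (rnorm (P (c t) tau - P t0 tau))%:E)%E \is a fin_num.
  apply: integrable_fin_num => //.
  apply: le_integrable intK => //.
    exact: (@mPB t).
  move=> tau _ /=; rewrite lee_fin ger0_norm ?rnorm_ge0// (le_trans (PB t tau))//.
  exact: ler_norm.
have F0 : F t @[t --> t0] --> (0 : R).
  (* Dominated convergence concerns sequences, hence the passage to sequences [v] tending to t0. *)
  apply/(@cvg_nbhsP _ R^o) => v vt0; apply: fine_cvg.
  have := @dominated_convergence _ _ R mu `[0, T]%classic (measurable_itv _)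
    (fun n tau => (rnorm (P (c (v n)) tau - P t0 tau))%:E) (cst 0%E)
    (fun tau => (2 * K * rnorm (f tau))%:E).
  case => //.
  - by move=> n; exact: mPB.
  - exists [set t0]; split => //; first exact: lebesgue_measure_set1.
    move=> tau /=; apply: contra_notP => taut0 Dtau.
    apply: cvg_EFin; first exact: nearW.
    apply/cvg_rnormP.
    have cv : c (v n) @[n --> \oo] --> t0.
      by rewrite -[X in _ --> X](ct t0 t00 t0T); apply: continuous_cvg => //; exact: ccont.
    move: Dtau; rewrite /= in_itv/= => /andP[tau0 tauT].
    have [tt|tt|//] := ltgtP tau t0.
      have PE s : tau <= s -> P s tau = U s tau (f tau).
        by move=> taus; rewrite /P /patch mem_set//= in_itv/= tau0.
      rewrite PE ?(ltW tt)//.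
      have cvtau : \forall n \near \oo, tau <= c (v n) by exact: (cvgr_ge _ cv).
      apply: (@cvg_trans _ (U (c (v n)) tau (f tau) @[n --> \oo])).
        by apply: near_eq_cvg; apply: filterS cvtau => n /PE.
      apply: evol_cvg => //; [exact: ltW| |exact: cvg_cst].
      by apply: filterS cvtau => n; rewrite tau0.
    have PE s : s < tau -> P s tau = 0.
      by move=> staus; rewrite /P /patch memNset//= in_itv/= => /andP[_]; rewrite leNgt staus.
    rewrite PE//.
    apply: (@cvg_trans _ ((cst 0 : nat -> X) n @[n --> \oo])); last exact: cvg_cst.
    have cvtau : \forall n \near \oo, c (v n) < tau by exact: (cvgr_lt _ cv).
    by apply: near_eq_cvg; apply: filterS cvtau => n /PE.
  - by apply: aeW => tau n _ /=; rewrite lee_fin ger0_norm ?rnorm_ge0//; exact: PB.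
  - by move=> _ _; rewrite integral0.
apply: (@cvg_rnorm_le _ _ _ _ _ _ _ F); last exact: cvg_within_filter.
rewrite near_withinE; near=> t; rewrite /Rplus /= in_itv/= andbT => t0'.
have tT : t <= T by near: t; apply: lt_le_nbhsl; rewrite ltrDl.
rewrite -lee_fin /F fineK// ct//.
by apply: opGB_rnorm_le; apply/andP; split.
Unshelve. all: by end_near. Qed.

End opG.

(** * Stability implies boundedness *)

Section exponential_integrals.
Context (R : realType).
Local Notation mu := (@lebesgue_measure R).

Lemma is_derive_expR_affine (a c x : R) : a != 0 ->
  is_derive x 1 (fun y => a^-1 * expR (a * (y - c))) (expR (a * (x - c))).
Proof.
move=> a0; apply: is_derive_eq.
by rewrite subr0 /GRing.scale /= mulr1 mulrCA mulVf ?mulr1.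
Qed.

Lemma continuous_expR_affine (a c : R) : continuous (fun y : R => expR (a * (y - c))).
Proof.
move=> y; apply: continuous_comp; last exact: continuous_expR.
by apply: cvgM; [exact: cvg_cst|apply: cvgB; [exact: cvg_id|exact: cvg_cst]].
Qed.

(** The mass of the convolution kernel in tau; [integral_expR_itvy_le] is its mass in t. The L^p
    estimate uses both, as in Schur's test. *)
Lemma integral_expR_itv_le (a t : R) : 0 < a -> 0 <= t ->
  (\int[mu]_(tau in `[0%R, t]) (expR (- a * (t - tau)))%:E <= (a^-1)%:E)%E.
Proof.
move=> a0; rewrite le_eqVlt => /orP[/eqP <-|t0].
  by rewrite set_itv1 integral_set1 lee_fin invr_ge0 ltW.
under eq_integral do rewrite mulNr -mulrN opprB.
rewrite (@continuous_FTC2 _ (fun y => expR (a * (y - t))) (fun y => a^-1 * expR (a * (y - t))))//.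
- rewrite subrr mulr0 expR0 mulr1 -EFinB lee_fin gerBl.
  by rewrite mulr_ge0 ?expR_ge0// invr_ge0 ltW.
- by apply: continuous_subspaceT; exact: continuous_expR_affine.
- split.
  + by move=> x _; have := is_derive_expR_affine t x (lt0r_neq0 a0) => -[].
  + apply: cvg_at_right_filter; apply: cvgM; first exact: cvg_cst.
    exact: continuous_expR_affine.
  + apply: cvg_at_left_filter; apply: cvgM; first exact: cvg_cst.
    exact: continuous_expR_affine.
- by move=> x _; rewrite derive1E; have := is_derive_expR_affine t x (lt0r_neq0 a0) => -[].
Qed.

Lemma cvg_expR_affine_y (a s : R) : 0 < a ->
  expR (- a * (t - s)) @[t --> +oo] --> (0 : R).
Proof.
move=> a0; apply/cvgr0Pnorm_lt => e e0; near=> t.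
rewrite ger0_norm ?expR_ge0// -[ltRHS](@lnK _ e) ?posrE// ltr_expR.
rewrite mulNr -mulrN opprB mulrC -ltr_pdivlMr// ltrBlDl -ltrBlDr.
by near: t; apply: nbhs_pinfty_gt; rewrite num_real.
Unshelve. all: by end_near. Qed.

Lemma integral_expR_itvy_le (a s : R) : 0 < a ->
  (\int[mu]_(t in `[s, +oo[) (expR (- a * (t - s)))%:E <= (a^-1)%:E)%E.
Proof.
move=> a0; have na : - a != 0 by rewrite oppr_eq0 lt0r_neq0.
rewrite (@ge0_continuous_FTC2y _ (fun y => expR (- a * (y - s)))
   (fun y => (- a)^-1 * expR (- a * (y - s))) s 0).
- by rewrite subrr mulr0 expR0 mulr1 -EFinB lee_fin invrN opprK add0r.
- by move=> *; rewrite expR_ge0.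
- by apply: continuous_subspaceT; exact: continuous_expR_affine.
- rewrite -[X in _ --> X](mulr0 (- a)^-1); apply: cvgM; first exact: cvg_cst.
  exact: cvg_expR_affine_y.
- by move=> x _; have := is_derive_expR_affine s x na => -[].
- apply: cvg_at_right_filter; apply: cvgM; first exact: cvg_cst.
  exact: continuous_expR_affine.
- by move=> x _; rewrite derive1E; have := is_derive_expR_affine s x na => -[].
Qed.

End exponential_integrals.

(** * Stability implies boundedness on C_0 *)

Section C0.
Context (R : realType) (X : completeNormedModType R[i]).
Local Notation mu := (@lebesgue_measure R).
Implicit Types f : R -> X.

Lemma continuous_rnorm_bounded f T : {within @Rplus R, continuous f} -> 0 <= T ->
  exists2 C, 0 <= C & forall t, 0 <= t <= T -> rnorm (f t) <= C.
Proof.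
move=> cf T0; have cr : {within `[0%R, T], continuous (fun t => rnorm (f t))}.
  have sub : `[0%R, T]%classic `<=` @Rplus R.
    by move=> s; rewrite /Rplus /= !in_itv/= andbT => /andP[].
  have := continuous_subspaceW sub cf => /subspace_continuousP h.
  by apply/subspace_continuousP => x /h; exact: cvg_rnorm.
have [c _ H] := EVT_max T0 cr.
exists (rnorm (f c)); first exact: rnorm_ge0.
by move=> t tT; apply: H; rewrite in_itv.
Qed.

Lemma bounded_loc_integrable f (C : R -> R) : simple_limit (@Rplus R) f ->
  (forall T t, 0 <= t <= T -> rnorm (f t) <= C T) -> loc_integrable f.
Proof.
move=> sf fC; split => // T T0.
apply: (@le_lt_trans _ _ (\int[mu]_(t in `[0%R, T]) (C T)%:E)%E); last first.
  rewrite integral_cst// lte_mul_pinfty//; last exact: itv0_fin.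
  by rewrite lee_fin (le_trans _ (fC T T _)) ?rnorm_ge0// lexx andbT.
apply: ge0_ae_le_integral_nomeas.
- by move=> t _; rewrite lee_fin rnorm_ge0.
- by move=> t _; rewrite lee_fin (le_trans _ (fC T T _)) ?rnorm_ge0// lexx andbT.
- by apply: aeW => t; rewrite /= in_itv/= lee_fin; exact: fC.
Qed.

Lemma C0_bounded f : C0_space X f -> exists2 C, 0 <= C &
  forall t, 0 <= t -> rnorm (f t) <= C.
Proof.
move=> [cf /cvg_rnormP/cvgr0Pnorm_lt/(_ _ ltr01)].
move=> -[T [_ HT]]; have [C C0 HC] := continuous_rnorm_bounded cf (normr_ge0 T).
exists (C + 1); first by rewrite addr_ge0.
move=> t t0; have [tT|tT] := leP t `|T|.
  by rewrite (le_trans (HC t _)) ?t0// lerDl.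
have := HT t (le_lt_trans (ler_norm T) tT).
rewrite subr0 ger0_norm ?rnorm_ge0// => /ltW h.
by rewrite (le_trans h)// lerDr.
Qed.

Lemma C0_loc_integrable f : C0_space X f -> loc_integrable f.
Proof.
move=> fC0; have [C _ HC] := C0_bounded fC0.
apply: (@bounded_loc_integrable _ (fun=> C)).
  by apply: continuous_simple_limit; case: fC0.
by move=> T t /andP[t0 _]; exact: HC.
Qed.

End C0.

Section stable_C0.
Context (R : realType) (X : completeNormedModType R[i]) (U : R -> R -> {linear X -> X}).
Hypothesis hU : evolution_family U.
Variables (M a : R).
Hypotheses (M1 : 1 <= M) (a0 : 0 < a) (hM : evol_growth U M (- a)).
Local Notation mu := (@lebesgue_measure R).

(** One estimate for two uses: [k = 0] bounds the norm of G, and small [c] gives the decay of Gf.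
    The rate a/2 is chosen below the rate a of the kernel because e^(-a(t-s)) e^(-(a/2)(s-T)) =
    e^(-(a/2)(t-T)) e^(-(a/2)(t-s)), which is still integrable in s; with rate a a factor t would
    remain. *)
Lemma opG_rnorm_le_exp (f : R -> X) (c k T t : R) : loc_integrable f -> 0 <= t ->
  0 <= c -> 0 <= k ->
  (forall s, 0 <= s <= t -> rnorm (f s) <= c + k * expR (- (a / 2) * (s - T))) ->
  rnorm (opG U f t) <= M * c / a + M * k * (2 / a) * expR (- (a / 2) * (t - T)).
Proof.
move=> lf t0 c0 k0 fck; have M0 : 0 <= M by rewrite (le_trans _ M1).
have b0 : 0 < a / 2 by rewrite divr_gt0.
rewrite -lee_fin; apply: (le_trans (opG_rnorm_le hU M1 hM lf t0)).
pose E := expR (- (a / 2) * (t - T)).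
have mexp (b : R) : measurable_fun `[0%R, t]%classic (fun s => expR (- b * (t - s))).
  apply: measurableT_comp => //; apply: measurable_funM => //.
  exact: measurable_funB.
apply: (@le_trans _ _ (\int[mu]_(s in `[0%R, t])
    ((M * c)%:E * (expR (- a * (t - s)))%:E +
     (M * k * E)%:E * (expR (- (a / 2) * (t - s)))%:E))%E).
  apply: ge0_ae_le_integral_nomeas.
  - by move=> s _; rewrite lee_fin !mulr_ge0 ?expR_ge0 ?rnorm_ge0.
  - by move=> s _; rewrite adde_ge0// lee_fin !mulr_ge0 ?expR_ge0.
  - apply: aeW => s; rewrite /= in_itv/= => /fck fs.
    rewrite -!EFinM -EFinD lee_fin.
    rewrite (@le_trans _ _ (M * expR (- a * (t - s)) * (c + k * expR (- (a / 2) * (s - T)))))//.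
      by rewrite ler_wpM2l// mulr_ge0 ?expR_ge0.
    rewrite mulrDr lerD//; first by rewrite -mulrA [_ * c]mulrC mulrA.
    have -> : M * expR (- a * (t - s)) * (k * expR (- (a / 2) * (s - T))) =
        M * k * (expR (- a * (t - s)) * expR (- (a / 2) * (s - T))) by ring.
    rewrite -[leRHS]mulrA /E -!expRD.
    by rewrite le_eqVlt; apply/orP; left; apply/eqP; congr (_ * expR _); field.
have int_le (b q : R) : 0 < b -> 0 <= q ->
    (\int[mu]_(s in `[0%R, t]) (q%:E * (expR (- b * (t - s)))%:E) <= (q / b)%:E)%E.
  move=> b_gt0 q0; rewrite ge0_integralZl//.
  - by rewrite EFinM lee_wpmul2l// integral_expR_itv_le.
  - by apply/measurable_EFinP; exact: (@mexp b).
rewrite ge0_integralD//.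
- rewrite EFinD leeD//; first by apply: int_le => //; rewrite mulr_ge0.
  apply: (le_trans (int_le _ _ b0 _)); first by rewrite !mulr_ge0 ?expR_ge0.
  by rewrite lee_fin /E invf_div le_eqVlt; apply/orP; left; apply/eqP; ring.
- by move=> s _; rewrite -EFinM lee_fin !mulr_ge0 ?expR_ge0.
- by apply/measurable_EFinP; apply: measurable_funM => //; exact: mexp.
- by move=> s _; rewrite -EFinM lee_fin !mulr_ge0 ?expR_ge0.
- by apply/measurable_EFinP; apply: measurable_funM => //; exact: mexp.
Qed.

Lemma opG_C0 (f : R -> X) : C0_space X f -> C0_space X (opG U f).
Proof.
move=> fC0; have lf := C0_loc_integrable fC0; have M0 : 0 < M by rewrite (lt_le_trans _ M1).
split; first exact: (opG_continuous hU M1 hM lf).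
have [C C0 HC] := C0_bounded fC0.
have b0 : 0 < a / 2 by rewrite divr_gt0.
apply/cvg_rnormP/cvgr0Pnorm_lt => e e0.
(* Chosen so that the persistent term [M * c / a] is exactly e/2. *)
pose c := e / 2 * a / M.
have c0 : 0 < c by rewrite !(mulr_gt0, divr_gt0, invr_gt0).
have [_ /cvg_rnormP/cvgr0Pnorm_lt/(_ _ c0)[T [_ HT]]] := fC0.
(* Up to T the exponential is at least 1, so the global bound [C] suffices; beyond T the function is
   already below [c]. *)
have dom (t s : R) : 0 <= s <= t -> rnorm (f s) <= c + C * expR (- (a / 2) * (s - T)).
  move=> /andP[s0 _]; have [sT|Ts] := leP s T.
    rewrite (le_trans (HC s s0))// -[leLHS]add0r lerD ?(ltW c0)//.
    rewrite ler_peMr// -[leLHS]expR0 ler_expR mulNr -mulrN opprB.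
    by rewrite mulr_ge0 ?(ltW b0)// subr_ge0.
  have := HT s Ts; rewrite subr0 ger0_norm ?rnorm_ge0// => /ltW h.
  by rewrite (le_trans h)// lerDl mulr_ge0 ?expR_ge0.
(* [C + 1] in place of [C] keeps the divisor positive when f = 0. *)
have K0 : 0 < M * (C + 1) * (2 / a)
  by apply: mulr_gt0; [apply: mulr_gt0 => //; rewrite ltr_wpDl|rewrite divr_gt0].
have := cvg_expR_affine_y T b0 => /cvgr0Pnorm_lt/(_ (e / 2 / (M * (C + 1) * (2 / a)))).
move=> /(_ _)/wrap[|small]; first by rewrite !divr_gt0.
near=> t.
have t0 : 0 <= t by near: t; apply: nbhs_pinfty_ge; rewrite num_real.
rewrite subr0 ger0_norm ?rnorm_ge0//.
apply: (le_lt_trans (opG_rnorm_le_exp lf t0 (ltW c0) C0 (dom t))).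
have cE : M * c / a = e / 2 by rewrite /c; field; rewrite !lt0r_neq0.
rewrite cE [ltRHS]splitr ltrD2l.
have : `|expR (- (a / 2) * (t - T))| < e / 2 / (M * (C + 1) * (2 / a)) by near: t.
rewrite ger0_norm ?expR_ge0// ltr_pdivlMr// => h; apply: le_lt_trans h.
rewrite mulrC ler_wpM2l ?expR_ge0// ler_wpM2r ?ler_wpM2l ?lerDl ?(ltW M0)//.
by rewrite divr_ge0// ltW.
Unshelve. all: by end_near. Qed.

Lemma opG_sup_norm_le (f : R -> X) : C0_space X f ->
  (sup_norm (opG U f) <= (M / a)%:E * sup_norm f)%E.
Proof.
move=> fC0; have lf := C0_loc_integrable fC0; have M0 : 0 <= M by rewrite (le_trans _ M1).
have [C C0 HC] := C0_bounded fC0.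
have fs t : 0 <= t -> ((rnorm (f t))%:E <= sup_norm f)%E.
  by move=> t0; apply: ereal_sup_ubound; exists t => //; rewrite /Rplus /= in_itv/= andbT.
have : (sup_norm f <= C%:E)%E.
  apply: ge_ereal_sup => _ [t + <-]; rewrite /Rplus /= in_itv/= andbT lee_fin.
  exact: HC.
have sge : (0 <= sup_norm f)%E by apply: le_trans (fs 0 _) => //; rewrite lee_fin rnorm_ge0.
move: fs sge; case: (sup_norm f) => [s fs|//|//]; rewrite !lee_fin => s0 _.
apply: ge_ereal_sup => _ [t + <-]; rewrite /Rplus /= in_itv/= andbT => t0.
rewrite lee_fin (le_trans (opG_rnorm_le_exp (T := 0) lf t0 s0 (lexx 0) _))//.
  by move=> r /andP[r0 _]; rewrite mul0r addr0 -lee_fin fs.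
by rewrite mulr0 !mul0r addr0 mulrAC.
Qed.

End stable_C0.

(** * Stability implies boundedness on L^p *)

Section powR_lemmas.
Context (R : realType).
Implicit Types x l p : R.

(** For x > l write x = x^(1-p) x^p and use that the exponent 1 - p is not positive. *)
Lemma le_add_powR x l p : 1 <= p -> 0 <= x -> 0 < l -> x <= l + l `^ (1 - p) * x `^ p.
Proof.
move=> p1 x0 l0; have [xl|lx] := leP x l.
  by rewrite (le_trans xl)// lerDl mulr_ge0 ?powR_ge0.
have xpos : 0 < x by exact: lt_trans lx.
rewrite -[leLHS]add0r lerD ?(ltW l0)// -[leLHS]powRr1 ?(ltW xpos)//.
rewrite -{1}(subrK p 1) powRD ?(gt_eqF xpos) ?implybT// ler_wpM2r ?powR_ge0//.
rewrite -(opprB p 1) !powRN lef_pV2 ?posrE ?powR_gt0//.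
by apply: ge0_ler_powR; rewrite ?nnegrE ?subr_ge0// ltW.
Qed.

(* The bound is optimized at l = J `^ p^-1. *)
Lemma powR_le_of_le_add (A B x J p : R) : 1 <= p -> 0 <= A -> 0 <= B -> 0 <= x -> 0 <= J ->
  (forall l, 0 < l -> x <= A * (B * l + l `^ (1 - p) * J)) ->
  x `^ p <= (A * (B + 1)) `^ p * J.
Proof.
move=> p1 A0 B0 x0 J0 H; have p0 : 0 < p by rewrite (lt_le_trans _ p1).
have AB0 : 0 <= A * (B + 1) by rewrite mulr_ge0 ?addr_ge0.
(* For J = 0 the optimal l would be 0, which is excluded; letting l tend to 0 gives x = 0
   instead. *)
move: J0; rewrite le_eqVlt => /orP[/eqP J0|J0].
  suff -> : x = 0 by rewrite powR0 ?gt_eqF// -J0 mulr0.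
  apply/eqP; rewrite eq_le x0 andbT; apply/ler_addgt0Pl => e e0; rewrite addr0.
  have := H (e / (A * (B + 1) + 1)); rewrite -J0 mulr0 addr0 => /(_ _)/wrap[|h].
    by rewrite divr_gt0// ltr_wpDl.
  apply: (le_trans h); rewrite !mulrA ler_pdivrMr ?ltr_wpDl// mulrC ler_wpM2l ?(ltW e0)//.
  by rewrite mulrDr mulr1 -addrA lerDl addr_ge0.
pose l := J `^ p^-1.
have l0 : 0 < l by exact: powR_gt0.
have lp : l `^ p = J by rewrite -powRrM mulVf ?gt_eqF// powRr1 ?ltW.
have lJ : l `^ (1 - p) * J = l.
  by rewrite -{1}lp -powRD ?subrK ?powRr1 ?(ltW l0)// (gt_eqF l0) implybT.
have := H l l0; rewrite lJ => h.
rewrite -lp -powRM ?(ltW l0)//; apply: ge0_ler_powR; rewrite ?nnegrE ?(ltW p0)//.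
  by rewrite mulr_ge0 ?(ltW l0).
by rewrite (le_trans h)// le_eqVlt; apply/orP; left; apply/eqP; ring.
Qed.

Lemma le_add1_powR x p : 1 <= p -> 0 <= x -> x <= 1 + x `^ p.
Proof. by move=> p1 x0; have := le_add_powR p1 x0 ltr01; rewrite powR1 mul1r. Qed.

End powR_lemmas.

Section Lp.
Context (R : realType) (X : completeNormedModType R[i]) (p : R).
Hypothesis p1 : 1 <= p.
Local Notation mu := (@lebesgue_measure R).
Implicit Types f g : R -> X.

Let p0 : 0 < p. Proof. by rewrite (lt_le_trans _ p1). Qed.

Definition Lp_integral f := (\int[mu]_(t in @Rplus R) (rnorm (f t) `^ p)%:E)%E.

Lemma Lp_integral_ge0 f : (0 <= Lp_integral f)%E.
Proof. by apply: integral_ge0 => t _; rewrite lee_fin powR_ge0. Qed.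

Lemma Lp_normE f : Lp_norm p f = (Lp_integral f `^ p^-1)%E.
Proof.
rewrite /Lp_norm unlock /Lp_integral [in RHS]integral_mkcond; congr (_ `^ _)%E.
apply: eq_integral => t _; rewrite !patchE; case: ifPn => _ /=.
  by rewrite ger0_norm ?rnorm_ge0.
by rewrite normr0 powR0 ?gt_eqF.
Qed.

Lemma Lp_norm_fin f : (Lp_norm p f < +oo)%E <-> (Lp_integral f < +oo)%E.
Proof.
rewrite Lp_normE; split; last exact: poweR_lty.
rewrite !ltey; apply: contra => /eqP ->.
by rewrite poweRyr// invr_eq0 gt_eqF.
Qed.

Lemma Lp_norm_le f g (C : R) : 0 <= C ->
  (Lp_integral f <= C%:E * Lp_integral g)%E ->
  (Lp_norm p f <= (C `^ p^-1)%:E * Lp_norm p g)%E.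
Proof.
move=> C0 fg; rewrite !Lp_normE -poweR_EFin -poweRM ?lee_fin ?Lp_integral_ge0//.
apply: gt0_ler_poweR => //; rewrite ?in_itv/= ?leey ?andbT ?Lp_integral_ge0//.
- by rewrite invr_ge0 ltW.
- by rewrite mule_ge0 ?Lp_integral_ge0.
Qed.

Lemma eq_Lp_integral f g : {ae mu, forall t, @Rplus R t -> f t = g t} ->
  Lp_integral f = Lp_integral g.
Proof.
move=> fg; apply: ge0_ae_eq_integral_nomeas.
- by move=> t _; rewrite lee_fin powR_ge0.
- by move=> t _; rewrite lee_fin powR_ge0.
- by apply: (@filterS _ _ (ae_filter_ringOfSetsType mu)) fg => t + Rt => ->.
Qed.

(** On an interval of finite length |f| <= 1 + |f|^p is enough. *)
Lemma Lp_loc_integrable f : simple_limit (@Rplus R) f -> (Lp_integral f < +oo)%E ->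
  loc_integrable f.
Proof.
move=> sf foo; split => // T T0.
have sub : `[0%R, T]%classic `<=` @Rplus R.
  by move=> s; rewrite /Rplus /= !in_itv/= andbT => /andP[].
have mp (D : set R) : D `<=` @Rplus R -> measurable_fun D (fun t => (rnorm (f t) `^ p)%:E).
  move=> DR; apply/measurable_EFinP; apply: (measurableT_comp (measurable_powR p)).
  exact: simple_limit_measurable_rnorm (simple_limit_sub DR sf).
apply: (@le_lt_trans _ _ (\int[mu]_(t in `[0%R, T]) (1%:E + (rnorm (f t) `^ p)%:E))%E).
  apply: ge0_ae_le_integral_nomeas.
  - by move=> t _; rewrite lee_fin rnorm_ge0.
  - by move=> t _; rewrite adde_ge0// lee_fin powR_ge0.
  - by apply: aeW => t _; rewrite -EFinD lee_fin le_add1_powR ?rnorm_ge0.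
rewrite ge0_integralD//; last 2 first.
- by move=> t _; rewrite lee_fin powR_ge0.
- exact: (@mp _ sub).
rewrite integral_cst// mul1e lte_add_pinfty//; first exact: itv0_fin.
apply: le_lt_trans foo; apply: ge0_subset_integral => //.
- exact: measurable_itv.
- exact: (@mp _ (fun x => id)).
- by move=> t _; rewrite lee_fin powR_ge0.
Qed.

(** The representative is a limit of simple functions on the whole line, so that the kernel of the
    convolution is measurable on the whole plane, as Tonelli's theorem requires. *)
Lemma Lp_representative f : Lp_space X p f ->
  exists g, [/\ simple_limit setT g, {ae mu, forall t, @Rplus R t -> f t = g t}
     & (Lp_integral g < +oo)%E].
Proof.
move=> [/strongly_measurable_simple_limit[g sg fg] /Lp_norm_fin foo].
exists (patch (fun=> 0) (@Rplus R) g).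
have fg' : {ae mu, forall t, @Rplus R t -> f t = patch (fun=> 0) (@Rplus R) g t}.
  by apply: (@filterS _ _ (ae_filter_ringOfSetsType mu)) fg => t h Rt; rewrite h// /patch mem_set.
split; [|exact: fg'|by rewrite -(eq_Lp_integral fg')].
apply: simple_limit_patch; first exact: measurable_itv.
by rewrite setTI.
Qed.

End Lp.

Section stable_Lp.
Context (R : realType) (X : completeNormedModType R[i]) (p : R).
Context (U : R -> R -> {linear X -> X}).
Hypotheses (p1 : 1 <= p) (hU : evolution_family U).
Variables (M a : R).
Hypotheses (M1 : 1 <= M) (a0 : 0 < a) (hM : evol_growth U M (- a)).
Local Notation mu := (@lebesgue_measure R).

Let M0 : 0 <= M. Proof. by rewrite (le_trans _ M1). Qed.

Section kernel.
Variable g : R -> X.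
Hypotheses (sg : simple_limit setT g) (goo : (Lp_integral p g < +oo)%E).

Let triangle : set (R * R) := [set z | 0 <= z.2 <= z.1].

(** The convolution of |g|^p with e^(-a t), with the constraint 0 <= tau <= t moved into an
    indicator so that both variables range over the line. *)
Definition conv_kernel (z : R * R) : \bar R :=
  (\1_triangle z * (expR (- a * (z.1 - z.2)) * rnorm (g z.2) `^ p))%:E.

Lemma conv_kernel_ge0 z : (0 <= conv_kernel z)%E.
Proof. by rewrite lee_fin !mulr_ge0 ?expR_ge0 ?powR_ge0. Qed.

Lemma measurable_conv_kernel : measurable_fun setT conv_kernel.
Proof.
have m1 : measurable_fun setT (fun z : R * R => z.1) by exact: measurable_fst.
have m2 : measurable_fun setT (fun z : R * R => z.2) by exact: measurable_snd.
apply/measurable_EFinP; apply: measurable_funM.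
  apply: measurable_indic.
  rewrite (_ : triangle = (setT `&` [set z | 0 <= z.2]) `&` (setT `&` [set z | z.2 <= z.1])).
    by apply: measurableI; apply: measurable_fun_le.
  apply/seteqP; split => z; rewrite /triangle/=; first by move=> /andP[].
  by move=> [[_ ->] [_ ->]].
apply: measurable_funM.
  by apply: measurableT_comp => //; apply: measurable_funM => //; exact: measurable_funB.
apply: (measurableT_comp (measurable_powR p)).
have mg : measurable_fun setT (fun t => rnorm (g t)) by exact: simple_limit_measurable_rnorm.
exact: (measurableT_comp mg m2).
Qed.

Definition conv_energy (t : R) : \bar R := (\int[mu]_tau conv_kernel (t, tau))%E.

Lemma conv_energy_ge0 t : (0 <= conv_energy t)%E.
Proof. by apply: integral_ge0 => tau _; exact: conv_kernel_ge0. Qed.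

Lemma conv_energyE t : 0 <= t -> conv_energy t =
  (\int[mu]_(tau in `[0%R, t]) (expR (- a * (t - tau)) * rnorm (g tau) `^ p)%:E)%E.
Proof.
move=> t0; rewrite [RHS]integral_mkcond; apply: eq_integral => tau _.
rewrite patchE /conv_kernel indicE.
have -> : ((t, tau) \in triangle) = (tau \in `[0%R, t]%classic).
  by apply/idP/idP => /set_mem/= h; apply/mem_set; move: h; rewrite /triangle /= in_itv.
by case: ifPn => _; rewrite ?mul1r ?mul0r.
Qed.

(** After Tonelli the section at tau >= 0 is the half-line from tau, where the exponential has mass
    at most 1/a; for tau < 0 it is empty. *)
Lemma integral_conv_energy_le :
  (\int[mu]_t conv_energy t <= (a^-1)%:E * Lp_integral p g)%E.
Proof.
rewrite [leLHS](@fubini_tonelli _ _ _ _ R mu mu _ measurable_conv_kernel conv_kernel_ge0).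
have mp : measurable_fun (@Rplus R) (fun t => (rnorm (g t) `^ p)%:E).
  apply/measurable_EFinP; apply: (measurableT_comp (measurable_powR p)).
  exact: simple_limit_measurable_rnorm (simple_limit_sub (@subsetT _ _) sg).
rewrite /Lp_integral -ge0_integralZl//; last 3 first.
- exact: measurable_itv.
- by move=> t _; rewrite lee_fin powR_ge0.
- by rewrite lee_fin invr_ge0 ltW.
rewrite [leRHS]integral_mkcond; apply: ge0_ae_le_integral_nomeas.
- by move=> tau _; apply: integral_ge0 => t _; exact: conv_kernel_ge0.
- move=> tau _; rewrite patchE; case: ifPn => // _.
  by rewrite mule_ge0// lee_fin ?powR_ge0// invr_ge0 ltW.
apply: aeW => tau _; rewrite patchE; case: ifPn => [|/negP tau0].
  move=> /set_mem; rewrite /Rplus /= in_itv/= andbT => tau0.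
  rewrite (_ : (\int[mu]_x conv_kernel (x, tau) =
    \int[mu]_(t in `[tau, +oo[) ((rnorm (g tau) `^ p)%:E * (expR (- a * (t - tau)))%:E))%E).
    rewrite ge0_integralZl//.
    - by rewrite muleC lee_wpmul2r ?lee_fin ?powR_ge0// integral_expR_itvy_le.
    - apply/measurable_EFinP; apply: measurableT_comp => //.
      by apply: measurable_funM => //; exact: measurable_funB.
    - by rewrite lee_fin powR_ge0.
  rewrite [RHS]integral_mkcond; apply: eq_integral => t _.
  rewrite patchE /conv_kernel indicE.
  have -> : ((t, tau) \in triangle) = (t \in `[tau, +oo[%classic).
    apply/idP/idP => /set_mem/= h; apply/mem_set; move: h; rewrite /triangle /= in_itv/= andbT.
      by move=> /andP[].
    by rewrite tau0.
  by case: ifPn => _; rewrite ?mul1r ?mul0r// mulrC EFinM.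
rewrite integral0_eq// => t _; rewrite /conv_kernel indicE memNset ?mul0r//.
rewrite /triangle /= => /andP[h _]; apply: tau0; apply/mem_set.
by rewrite /Rplus /= in_itv/= h.
Qed.

(** Integrating [le_add_powR] against M e^(-a(t-s)) gives the hypothesis of [powR_le_of_le_add] with
    A = M, B = 1/a and J the value of [conv_energy]. *)
Lemma opG_powR_le t : 0 <= t ->
  ((rnorm (opG U g t) `^ p)%:E <= ((M * (a^-1 + 1)) `^ p)%:E * conv_energy t)%E.
Proof.
move=> t0; have ia0 : 0 <= a^-1 by rewrite invr_ge0 ltW.
have lg : loc_integrable g.
  by apply: (Lp_loc_integrable p1) => //; exact: simple_limit_sub sg.
have ABp : 0 < (M * (a^-1 + 1)) `^ p.
  by rewrite powR_gt0// mulr_gt0 ?(lt_le_trans _ M1)// ltr_wpDl.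
(* An infinite right-hand side is trivial, because the constant in front is positive. *)
have [Joo|Joo] := eqVneq (conv_energy t) +oo%E.
  by rewrite Joo gt0_muley ?lte_fin// leey.
have Jfin : conv_energy t \is a fin_num by rewrite ge0_fin_numE ?conv_energy_ge0// ltey.
rewrite -(fineK Jfin) -EFinM lee_fin.
apply: powR_le_of_le_add => //; first exact: rnorm_ge0.
  by rewrite fine_ge0// conv_energy_ge0.
move=> l l0; rewrite -lee_fin; apply: (le_trans (opG_rnorm_le hU M1 hM lg t0)).
pose k := l `^ (1 - p); have k0 : 0 <= k by exact: powR_ge0.
have mexp : measurable_fun `[0%R, t]%classic (fun s => expR (- a * (t - s))).
  apply: measurableT_comp => //; apply: measurable_funM => //.
  exact: measurable_funB.
have mexpg : measurable_fun `[0%R, t]%classic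
    (fun s => expR (- a * (t - s)) * rnorm (g s) `^ p).
  apply: measurable_funM => //; apply: (measurableT_comp (measurable_powR p)).
  exact: simple_limit_measurable_rnorm (simple_limit_sub (@subsetT _ _) sg).
apply: (@le_trans _ _ (\int[mu]_(s in `[0%R, t]) (M%:E *
   (l%:E * (expR (- a * (t - s)))%:E +
     k%:E * (expR (- a * (t - s)) * rnorm (g s) `^ p)%:E)))%E).
  apply: ge0_ae_le_integral_nomeas.
  - by move=> s _; rewrite lee_fin !mulr_ge0 ?expR_ge0 ?rnorm_ge0.
  - move=> s _; rewrite mule_ge0// adde_ge0// lee_fin !mulr_ge0 ?expR_ge0 ?powR_ge0//.
    exact: ltW.
  - apply: aeW => s _.
    suff : M * expR (- a * (t - s)) * rnorm (g s) <=
        M * (l * expR (- a * (t - s)) + k * (expR (- a * (t - s)) * rnorm (g s) `^ p)).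
      by rewrite -lee_fin.
    rewrite -mulrA ler_wpM2l//.
    have := le_add_powR p1 (rnorm_ge0 (g s)) l0; rewrite -/k => h.
    rewrite (le_trans (ler_wpM2l (expR_ge0 _) h))// le_eqVlt.
    by apply/orP; left; apply/eqP; ring.
rewrite ge0_integralZl//; first last.
- by move=> s _; rewrite adde_ge0// lee_fin !mulr_ge0 ?expR_ge0 ?powR_ge0// ltW.
- apply: emeasurable_funD; apply/measurable_EFinP; apply: measurable_funM => //.
rewrite EFinM lee_wpmul2l ?lee_fin//.
rewrite ge0_integralD//; first last.
- by apply/measurable_EFinP; apply: measurable_funM.
- by move=> s _; rewrite lee_fin !mulr_ge0 ?expR_ge0 ?powR_ge0.
- by apply/measurable_EFinP; apply: measurable_funM.
- by move=> s _; rewrite lee_fin !mulr_ge0 ?expR_ge0// ltW.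
rewrite ge0_integralZl//; first last.
- by rewrite lee_fin ltW.
- exact/measurable_EFinP.
rewrite ge0_integralZl//; first last.
- by move=> s _; rewrite lee_fin !mulr_ge0 ?expR_ge0 ?powR_ge0.
- exact/measurable_EFinP.
rewrite -conv_energyE// EFinD [X in (_ <= _ + X)%E]EFinM fineK// leeD//.
rewrite mulrC EFinM lee_wpmul2l ?lee_fin ?(ltW l0)//.
exact: integral_expR_itv_le.
Qed.

Lemma opG_Lp_integral_le :
  (Lp_integral p (opG U g) <= ((M * (a^-1 + 1)) `^ p * a^-1)%:E * Lp_integral p g)%E.
Proof.
pose C := (M * (a^-1 + 1)) `^ p; have C0 : 0 <= C by exact: powR_ge0.
apply: (@le_trans _ _ (\int[mu]_(t in @Rplus R) (C%:E * conv_energy t))%E).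
  apply: ge0_ae_le_integral_nomeas.
  - by move=> t _; rewrite lee_fin powR_ge0.
  - by move=> t _; rewrite mule_ge0// conv_energy_ge0.
  - apply: aeW => t; rewrite /Rplus /= in_itv/= andbT; exact: opG_powR_le.
have mJ : measurable_fun setT conv_energy.
  exact: (@measurable_fun_fubini_tonelli_F _ _ _ _ R mu _ measurable_conv_kernel conv_kernel_ge0).
rewrite EFinM -muleA ge0_integralZl//; first last.
- by move=> t _; exact: conv_energy_ge0.
- exact: measurable_funTS.
- exact: measurable_itv.
rewrite lee_wpmul2l// (le_trans _ integral_conv_energy_le)//.
apply: ge0_subset_integral => //; first exact: measurable_itv.
by move=> t _; exact: conv_energy_ge0.
Qed.

End kernel.

Lemma stable_bounded_Lp :
  bounded_operator_on (Lp_space X p) (@Lp_norm _ _ p) (opG U).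
Proof.
have ia0 : 0 <= a^-1 by rewrite invr_ge0 ltW.
pose C := (M * (a^-1 + 1)) `^ p * a^-1.
have C0 : 0 <= C by rewrite mulr_ge0 ?powR_ge0.
(* A change of f on a null set leaves Gf unchanged at every t, not merely at almost every t. *)
have red f : Lp_space X p f -> exists g, [/\ simple_limit setT g,
    (Lp_integral p g < +oo)%E, Lp_integral p f = Lp_integral p g &
    forall t, opG U f t = opG U g t].
  move=> /(Lp_representative p1)[g [sg fg goo]].
  exists g; split; [exact: sg|exact: goo|exact: eq_Lp_integral|move=> t].
  apply: eq_bochner_integral.
  apply: (@filterS _ _ (ae_filter_ringOfSetsType mu)) fg => s h.
  rewrite /= in_itv/= => /andP[s0 _]; by rewrite h// /Rplus /= in_itv/= s0.
have leG f : Lp_space X p f -> (Lp_integral p (opG U f) <= C%:E * Lp_integral p f)%E.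
  move=> /red[g [sg goo fg /funext Gfg]]; rewrite fg Gfg.
  exact: opG_Lp_integral_le.
split => [f fLp|].
  have [g [sg goo fg /funext Gfg]] := red f fLp.
  have lg : loc_integrable g.
    exact: (Lp_loc_integrable p1 (simple_limit_sub (@subsetT _ _) sg) goo).
  split.
    (* Strong measurability of Gf is obtained from its continuity. *)
    apply: simple_limit_strongly_measurable; apply: continuous_simple_limit.
    by rewrite Gfg; exact: (opG_continuous hU M1 hM lg).
  apply/(Lp_norm_fin p1); apply: (le_lt_trans (leG f fLp)).
  by rewrite fg; apply: lte_mul_pinfty; [rewrite lee_fin| |exact: goo].
exists (C `^ p^-1) => h hLp; apply: (Lp_norm_le p1) => //; exact: leG.
Qed.

End stable_Lp.

(** * Boundedness implies stability *)

Section criterion.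
Context (R : realType) (X : normedModType R[i]) (U : R -> R -> {linear X -> X}).
Hypothesis hU : evolution_family U.

(** The time t - s is divided into blocks of length [L], each of which halves the norm; the
    remaining piece costs the factor [K]. *)
Lemma evol_geometric_stable (K L : R) : 1 <= K -> 0 < L ->
  (forall t s x, 0 <= s -> s <= t -> rnorm (U t s x) <= K * rnorm x) ->
  (forall t s x, 0 <= s -> s + L <= t -> rnorm (U t s x) <= 2^-1 * rnorm x) ->
  exponentially_stable U.
Proof.
move=> K1 L0 UK Uhalf; have K0 : 0 <= K by rewrite (le_trans _ K1).
have geo n : forall t s x, 0 <= s -> s + n%:R * L <= t ->
    rnorm (U t s x) <= K * 2^-1 ^+ n * rnorm x.
  elim: n => [|n IH] t s x s0.
    by rewrite mul0r addr0 expr0 mulr1; exact: UK.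
  rewrite -natr1 mulrDl mul1r => tL.
  have nL0 : 0 <= n%:R * L by rewrite mulr_ge0// ltW.
  have sL0 : 0 <= s + L by rewrite addr_ge0// ltW.
  have sLn : s + L + n%:R * L <= t by rewrite -addrA [L + _]addrC.
  rewrite (evol_comp hU s0 _ (s := s + L)); last 2 first.
  - by rewrite lerDl ltW.
  - by rewrite (le_trans _ sLn)// lerDl.
  apply: (le_trans (IH _ _ _ sL0 sLn)).
  rewrite exprSr mulrA -[leRHS]mulrA ler_wpM2l ?mulr_ge0 ?exprn_ge0//.
  exact: Uhalf.
(* The number n of full blocks satisfies n + 1 > (t - s)/L, so 2^(-n) is at most 2 e^(-(ln 2/L)(t -
   s)); the factor 2 pays for the incomplete block. *)
exists (K * 2), (- (ln 2 / L)); split.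
- by rewrite (le_trans K1)// ler_peMr// ler1n.
- by rewrite oppr_lt0 divr_gt0// ln_gt0// ltr1n.
apply/(exp_boundP _ _).
  by rewrite (le_trans K1)// ler_peMr// ler1n.
move=> t s x s0 st.
have q0 : 0 <= (t - s) / L by rewrite divr_ge0 ?subr_ge0// ltW.
pose n := Num.truncn ((t - s) / L).
have /andP[n1 n2] := truncn_itv q0; rewrite -/n in n1 n2.
apply: (@le_trans _ _ (K * 2^-1 ^+ n * rnorm x)).
  by apply: geo => //; rewrite addrC -lerBrDr -ler_pdivlMr.
rewrite ler_wpM2r ?rnorm_ge0// -mulrA ler_wpM2l//.
rewrite -[X in _ <= X * _](@lnK _ 2) ?posrE// -expRD.
have -> : 2^-1 ^+ n = expR (- (ln 2 * n%:R)) :> R.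
  by rewrite expRN mulrC expRM_natl lnK ?posrE// exprVn.
have l0 : 0 < ln 2 :> R by rewrite ln_gt0// ltr1n.
have -> : - (ln 2 / L) * (t - s) = - (ln 2 * ((t - s) / L)) by ring.
by move: (ltW n2); rewrite ler_expR -natr1 -(ler_pM2l l0); lra.
Qed.

(* T = 1 together with the growth bound makes U uniformly bounded by some K;
   applying the hypothesis again with this K and with T large makes U a
   contraction by 1/2 over time T + 1. *)
Lemma evol_stability_criterion (M w c r : R) : 1 <= M -> evol_growth U M w ->
  0 <= c -> 0 < r ->
  (forall T K, 1 <= T -> 0 < K ->
    (forall t s x, 0 <= s -> s <= t -> t - s <= T -> rnorm (U t s x) <= K * rnorm x) ->
    forall t s x, 0 <= s -> s + T + 1 <= t ->
      T `^ r * rnorm (U t s x) <= c * K * rnorm x) ->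
  exponentially_stable U.
Proof.
move=> M1 hM c0 r0 H; have M0 : 0 < M by rewrite (lt_le_trans _ M1).
have UT := evol_growth_loc M1 hM.
(* [K1] is the local bound that [H] needs for T = 1; [K2] covers times up to T + 1 = 2, on which [H]
   says nothing. *)
pose K1 := M * expR (`|w| * 1); pose K2 := M * expR (`|w| * 2).
have K10 : 0 < K1 by rewrite mulr_gt0// expR_gt0.
have K21 : 1 <= K2.
  rewrite -[leLHS]mulr1 ler_pM// -[leLHS]expR0 ler_expR mulr_ge0//.
pose K := c * K1 + K2.
have K_1 : 1 <= K by rewrite (le_trans K21)// lerDr mulr_ge0// ltW.
have K0 : 0 < K by rewrite (lt_le_trans _ K_1).
have UK t s x : 0 <= s -> s <= t -> rnorm (U t s x) <= K * rnorm x.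
  move=> s0 st; have [ts|ts] := leP (t - s) 2.
    apply: (le_trans (UT _ _ _ x s0 st ts)).
    by rewrite ler_wpM2r ?rnorm_ge0// lerDr mulr_ge0// ltW.
  have := H 1 K1 (lexx 1) K10 (fun t s x s0 st ts => UT 1 t s x s0 st ts) t s x s0.
  rewrite powR1 mul1r => /(_ _)/wrap[|h]; first lra.
  rewrite (le_trans h)// ler_wpM2r ?rnorm_ge0// lerDl.
  by rewrite (le_trans _ K21).
(* Chosen so that c K / T^r is below 1/2; the summand 1 also ensures T >= 1. *)
pose T := (2 * (c * K) + 1) `^ r^-1.
have cK0 : 0 <= c * K by rewrite mulr_ge0// ltW.
have Tr : T `^ r = 2 * (c * K) + 1.
  by rewrite -powRrM mulVf ?gt_eqF// powRr1// addr_ge0// mulr_ge0.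
have T1 : 1 <= T.
  rewrite -[leLHS](powRr0 (2 * (c * K) + 1)) ler_powR ?invr_ge0 ?(ltW r0)//.
  by rewrite lerDr mulr_ge0.
apply: (@evol_geometric_stable K (T + 1)) => //; first by rewrite ltr_wpDl// (le_trans _ T1).
move=> t s x s0; rewrite addrA => sTt.
have := H T K T1 K0 (fun t s x s0 st _ => UK t s x s0 st) t s x s0 sTt.
rewrite Tr; have := rnorm_ge0 (U t s x); have := rnorm_ge0 x.
set u := rnorm (U t s x); set y := rnorm x; set q := c * K in cK0 *.
move=> y0 u0 h.
rewrite -(ler_pM2l (_ : 0 < 2 * q + 1)); last by rewrite ltr_wpDl// mulr_ge0.
apply: (le_trans h); rewrite mulrA ler_wpM2r//; lra.
Qed.

End criterion.

Section constant_integrand.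
Context (R : realType) (X : completeNormedModType R[i]).
Local Notation mu := (@lebesgue_measure R).

(** The one integral with an explicit value: G of the L^p test function equals it, and G of the C_0
    test function is compared with it. *)
Lemma is_bochner_integral_cst_itv (s T t : R) (y : X) : 0 <= s -> 0 <= T -> s + T <= t ->
  is_bochner_integral mu `[0%R, t]%classic
    (patch (fun=> 0) `[s, s + T]%classic (fun=> y)) (T%:C *: y).
Proof.
move=> s0 T0 st; apply: is_bochner_integral_patch => //; first exact: itv0_fin.
  move=> r; rewrite /= !in_itv/= => /andP[sr rT].
  by rewrite (le_trans s0 sr) (le_trans rT).
have muT : mu `[s, s + T]%classic = T%:E.
  rewrite lebesgue_measure_itv/= lte_fin; case: ltP => sT.
    by rewrite -EFinD addrAC subrr add0r.
  by congr EFin; apply/esym/eqP; rewrite eq_le T0 andbT; move: sT; rewrite gerDl.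
have sy := msimple_cst (measurableTypeR R) y.
exists (fun=> fimfun_of (proj1 sy)); split.
- move=> n; split; first by move=> x; exact: (proj2 sy).
  move=> x _; apply: (@le_lt_trans _ _ T%:E); last exact: ltry.
  rewrite -muT; apply: le_measure; [|exact/mem_set|exact: subIsetl].
  by apply/mem_set/measurableI => //; exact: (proj2 sy).
- by apply: aeW => r _; exact: cvg_cst.
- rewrite (_ : (fun _ => _) = cst 0%E); first exact: cvg_cst.
  by apply/funext => n; apply: integral0_eq => r _; rewrite subrr rnorm0.
- rewrite (_ : (fun _ => _) = cst (T%:C *: y)); first exact: cvg_cst.
  apply/funext => n; rewrite /simple_integral /=.
  have -> : range (fun _ : measurableTypeR R => y) = [set y].
    by apply/seteqP; split => [_ [r _ <-]//|_ ->]; exists 0.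
  rewrite fsbig_set1 (_ : _ `&` _ = `[s, s + T]%classic) ?muT//.
  by apply/seteqP; split => r //= [].
Qed.

End constant_integrand.

(** * The converse on C_0 *)

Section trapezoid.
Context (R : realType).
Implicit Types s T t : R.

(** A continuous cutoff on [[s, s + T]]: flanks of length T/4 and slope 4/T, and height 1 on the
    middle half. *)
Definition trapezoid s T t : R :=
  Num.max 0 (Num.min 1 (Num.min ((t - s) * (4 / T)) ((s + T - t) * (4 / T)))).

Lemma trapezoid_itv s T t : 0 <= trapezoid s T t <= 1.
Proof. by rewrite /trapezoid le_max lexx ge_max ler01 ge_min lexx. Qed.

Lemma trapezoid_out s T t : 0 < T -> ~~ (s < t < s + T) -> trapezoid s T t = 0.
Proof.
move=> T0 st; apply/max_idPl; rewrite !ge_min; move: st; rewrite negb_and -!leNgt => /orP[st|st].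
  by rewrite [X in _ || (X || _)]mulr_le0_ge0 ?orbT ?subr_le0// divr_ge0// ltW.
by rewrite [X in _ || (_ || X)]mulr_le0_ge0 ?orbT ?subr_le0// divr_ge0// ltW.
Qed.

Lemma trapezoid1 s T t : 0 < T -> s + T / 4 <= t <= s + T - T / 4 -> trapezoid s T t = 1.
Proof.
move=> T0 /andP[h1 h2]; rewrite /trapezoid.
have T4 : 0 <= 4 / T by rewrite divr_ge0// ltW.
have e : (T / 4) * (4 / T) = 1 by field; rewrite gt_eqF.
rewrite (min_idPl _) ?(max_idPr ler01)// le_min.
by apply/andP; split; rewrite -[leLHS]e ler_wpM2r//; lra.
Qed.

Lemma continuous_trapezoid s T : continuous (trapezoid s T).
Proof.
pose u t := (t - s) * (4 / T); pose v t := (s + T - t) * (4 / T).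
move=> t; apply: (@continuous_max R R (cst 0) (fun t => Num.min 1 (Num.min (u t) (v t)))).
  exact: cst_continuous.
apply: (@continuous_min R R (cst 1) (fun t => Num.min (u t) (v t))).
  exact: cst_continuous.
apply: (@continuous_min R R u v).
  by apply: cvgM; [apply: cvgB; [exact: cvg_id|exact: cvg_cst]|exact: cvg_cst].
by apply: cvgM; [apply: cvgB; [exact: cvg_cst|exact: cvg_id]|exact: cvg_cst].
Qed.

End trapezoid.

Lemma cvg_rscale (R : realType) (X : normedModType R[i]) (I : Type) (F : set_system I)
    (FF : Filter F) (c : I -> R) (v : I -> X) (a : R) (y : X) :
  c @ F --> a -> v @ F --> y -> (c i)%:C *: v i @[i --> F] --> a%:C *: y.
Proof.
move=> ca vy.
apply: (@cvg_rnorm_le _ _ _ _ _ _ _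
  (fun i => `|c i - a| * rnorm (v i) + `|a| * rnorm (v i - y))).
  apply: nearW => i; apply: (le_trans (rdistD (a%:C *: v i) _ _)).
  by rewrite -scalerBl -scalerBr -rmorphB !rnormZ.
rewrite -[X in _ --> X]addr0; apply: cvgD.
  rewrite -[X in _ --> X](mul0r (rnorm y)); apply: cvgM; last exact: cvg_rnorm.
  rewrite -[X in _ --> X](@normr0 R R) -(subrr a); apply: cvg_norm.
  by apply: cvgB => //; exact: cvg_cst.
rewrite -[X in _ --> X](mulr0 `|a|); apply: cvgM; first exact: cvg_cst.
exact/cvg_rnormP.
Qed.

Section converse.
Context (R : realType) (X : completeNormedModType R[i]) (U : R -> R -> {linear X -> X}).
Hypothesis hU : evolution_family U.
Variables (M w : R).
Hypotheses (M1 : 1 <= M) (hM : evol_growth U M w).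
Local Notation mu := (@lebesgue_measure R).

(** The maximum continues the orbit by its initial value x to the left of [s], so that it is
    continuous on the line; the cutoffs remove that part. *)
Lemma orbit_continuous (s : R) (x : X) : 0 <= s ->
  continuous (fun tau : R => U (Num.max tau s) s x).
Proof.
move=> s0 tau; apply: (@evol_cvg _ _ _ hU _ (nbhs tau) _ (fun t => Num.max t s) (cst s)) => //.
- by rewrite le_max lexx orbT.
- by apply: nearW => t; rewrite s0 le_max lexx orbT.
- apply: (@continuous_max R R id (cst s)); [exact: cvg_id|exact: cst_continuous].
- exact: cvg_cst.
Qed.

Section C0.
Variables (s T : R) (x : X).
Hypotheses (s0 : 0 <= s) (T0 : 0 < T).

Let f (tau : R) : X := (trapezoid s T tau)%:C *: U (Num.max tau s) s x.

Lemma trapezoid_orbit_C0 : C0_space X f.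
Proof.
split.
  apply: continuous_subspaceT => tau; apply: cvg_rscale; first exact: continuous_trapezoid.
  exact: orbit_continuous.
apply: (@cvg_trans _ ((cst 0 : R -> X) tau @[tau --> +oo])); last exact: cvg_cst.
apply: near_eq_cvg; near=> tau; rewrite /f trapezoid_out ?scale0r//.
rewrite negb_and -!leNgt; apply/orP; right.
by near: tau; apply: nbhs_pinfty_ge; rewrite num_real.
Unshelve. all: by end_near. Qed.

Lemma trapezoid_orbit_rnorm_le K tau :
  (forall t, s <= t -> t - s <= T -> rnorm (U t s x) <= K * rnorm x) -> 0 <= K ->
  rnorm (f tau) <= K * rnorm x.
Proof.
move=> UK K0; rewrite /f; have [/andP[st tT]|st] := boolP (s < tau < s + T); last first.
  by rewrite trapezoid_out// scale0r rnorm0 mulr_ge0// rnorm_ge0.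
have /andP[p0 p1] := trapezoid_itv s T tau.
rewrite rnormZ ger0_norm// (max_idPl (ltW st)) -[leRHS]mul1r ler_pM// ?rnorm_ge0//.
by apply: UK; [exact: ltW|rewrite lerBlDl ltW].
Qed.

(** The integral of the trapezoid need not be computed: replacing the cutoff by the indicator of
    [[s, s + T]] gives exactly T y, and the error is at most |y| on the two flanks, of total length
    T/2. *)
Lemma opG_trapezoid_orbit_ge (t : R) : s + T <= t ->
  T / 2 * rnorm (U t s x) <= rnorm (opG U f t).
Proof.
move=> sTt; set y := U t s x; have t0 : 0 <= t by rewrite (le_trans _ sTt)// addr_ge0// ltW.
have lf := C0_loc_integrable trapezoid_orbit_C0.
have T4 : s + T / 4 < s + T - T / 4 by move: T0; lra.
pose D : set R := `[0%R, t]%classic; pose A : set R := `[s, s + T]%classic.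
pose B : set R := `[s + T / 4, s + T - T / 4]%classic.
have mA : measurable A by exact: measurable_itv.
have mB : measurable B by exact: measurable_itv.
have mD : measurable D by exact: measurable_itv.
have Doo : (mu D < +oo)%E by exact: itv0_fin.
(* The cocycle identity applies for tau > s; for tau <= s both sides are 0 because the cutoff
   vanishes. *)
have fE tau : D tau -> U t tau (f tau) = (trapezoid s T tau)%:C *: y.
  rewrite /D /= in_itv/= => /andP[tau0 taut]; rewrite /f linearZ /=.
  have [taus|staus] := leP tau s.
    by rewrite trapezoid_out ?scale0r// negb_and -leNgt taus.
  by rewrite -(evol_comp hU s0 (ltW staus) taut).
have sf : simple_limit D (fun tau => U t tau (f tau)).
  apply: (simple_limit_evol hU M1 hM t0); apply: simple_limit_sub (proj1 lf).
  by move=> r; rewrite /Rplus /= !in_itv/= andbT => /andP[].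
have sA : simple_limit D (patch (fun=> 0) A (fun=> y)).
  by apply/msimple_simple_limit/msimple_patch; [exact: measurable_itv|exact: msimple_cst..].
have := is_bochner_integralB (mu := mu) mD Doo sf sA
  (opG_is_bochner_integral hU M1 hM lf t0)
  (is_bochner_integral_cst_itv y s0 (ltW T0) sTt).
move=> /(is_bochner_integral_rnorm_le (mu := mu) mD Doo (simple_limitB sf sA)).
have bound : (\int[mu]_(tau in D) (rnorm (((fun tau => U t tau (f tau)) \-
     patch (fun=> 0) A (fun=> y)) tau))%:E <= (T / 2 * rnorm y)%:E)%E.
  apply: (@le_trans _ _ (\int[mu]_(tau in D) ((rnorm y)%:E * (\1_(A `\` B) tau)%:E))%E).
    apply: ge0_ae_le_integral_nomeas.
    - by move=> tau _; rewrite lee_fin rnorm_ge0.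
    - by move=> tau _; rewrite mule_ge0 ?lee_fin ?rnorm_ge0.
    - apply: aeW => tau Dtau; rewrite -EFinM lee_fin /= fE// /patch.
      have /andP[p0 p1] := trapezoid_itv s T tau.
      have [/set_mem Atau|/negP nA] := boolP (tau \in A); last first.
        rewrite subr0 trapezoid_out ?scale0r ?rnorm0 ?mulr_ge0 ?rnorm_ge0//.
        apply: contra_notN nA => /andP[h1 h2]; apply/mem_set.
        by rewrite /A /= in_itv/= !ltW.
      rewrite -{2}[y]scale1r -scalerBl -(rmorph1 (@real_complex R)) -rmorphB rnormZ.
      have [Btau|nB] := pselect (B tau).
        by rewrite trapezoid1// subrr normr0 mul0r mulr_ge0 ?rnorm_ge0.
      rewrite indicE mem_set//= mulrC ler_wpM2l ?rnorm_ge0//.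
      by rewrite ler0_norm ?subr_le0// opprB lerBlDr lerDl.
  rewrite ge0_integralZl//; last 2 first.
  - by apply/measurable_EFinP; apply: measurable_indic; exact: measurableD.
  - by rewrite lee_fin rnorm_ge0.
  rewrite mulrC EFinM lee_wpmul2l ?lee_fin ?rnorm_ge0//.
  rewrite integral_indic//; last exact: measurableD.
  apply: (@le_trans _ _ (mu (A `\` B))).
    apply: le_measure; last exact: subIsetl.
      by apply/mem_set/measurableI => //; exact: measurableD.
    by apply/mem_set; exact: measurableD.
  have BA : B `<=` A.
    move=> r; rewrite /A /B /= !in_itv/= => /andP[h1 h2].
    have T40 : 0 <= T / 4 by rewrite divr_ge0// ltW.
    by rewrite (le_trans _ h1) ?lerDl// (le_trans h2)// gerBl.
  have muA : mu A = T%:E.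
    by rewrite lebesgue_measure_itv/= lte_fin ltrDl T0 -EFinD addrAC subrr add0r.
  have muB : mu B = (T / 2)%:E.
    rewrite lebesgue_measure_itv/= lte_fin ifT; last exact: T4.
    by rewrite -EFinD; congr EFin; field.
  have Aoo : (mu A < +oo)%E by rewrite muA ltry.
  have -> : mu (A `\` B) = (mu A - mu (A `&` B))%E.
    by apply: measureD => //; exact: Aoo.
  by rewrite (setIidr BA) muA muB -EFinD lee_fin; move: T0; lra.
move=> /le_trans/(_ bound); rewrite lee_fin => h.
have := rdistD (opG U f t) (T%:C *: y) 0.
rewrite !subr0 rnormZ ger0_norm ?(ltW T0)// rdistC; lra.
Qed.

End C0.

Lemma bounded_C0_stable :
  bounded_operator_on (C0_space X) (@sup_norm _ _) (opG U) -> exponentially_stable U.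
Proof.
move=> [_ [C HC]].
(* The factor 2 undoes the T/2 of the lower bound; the absolute value is taken because [C] is not
   assumed nonnegative. *)
apply: (@evol_stability_criterion _ _ _ hU M w (2 * `|C|) 1 M1 hM) => //.
move=> T K T1 K0 UK t s x s0 sTt; have T0 : 0 < T by rewrite (lt_le_trans _ T1).
have sTt' : s + T <= t by rewrite (le_trans _ sTt)// lerDl.
have ge := opG_trapezoid_orbit_ge x s0 T0 sTt'.
set f := (fun tau => _) in ge.
have fC0 : C0_space X f by exact: trapezoid_orbit_C0.
have fK : (sup_norm f <= (K * rnorm x)%:E)%E.
  apply: ge_ereal_sup => _ [tau _ <-]; rewrite lee_fin.
  by apply: trapezoid_orbit_rnorm_le => //; [move=> r sr rT; exact: UK|exact: ltW].
have f0 : (0 <= sup_norm f)%E.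
  apply: (@le_trans _ _ (rnorm (f 0))%:E); first by rewrite lee_fin rnorm_ge0.
  by apply: ereal_sup_ubound; exists 0 => //; rewrite /Rplus /= in_itv/= lexx.
have le1 : rnorm (opG U f t) <= `|C| * (K * rnorm x).
  rewrite -lee_fin EFinM.
  apply: (@le_trans _ _ (sup_norm (opG U f))).
    apply: ereal_sup_ubound; exists t => //; rewrite /Rplus /= in_itv/= andbT.
    by rewrite (le_trans _ sTt')// addr_ge0// ltW.
  apply: (le_trans (HC f fC0)).
  apply: (@le_trans _ _ (`|C|%:E * sup_norm f)%E).
    by rewrite lee_wpmul2r// lee_fin ler_norm.
  by rewrite lee_wpmul2l// lee_fin.
rewrite powRr1 ?(ltW T0)//; lra.
Qed.

End converse.

(** * The converse on L^p *)

Section converse_Lp.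
Context (R : realType) (X : completeNormedModType R[i]) (p : R) (U : R -> R -> {linear X -> X}).
Hypotheses (p1 : 1 <= p) (hU : evolution_family U).
Variables (M w : R).
Hypotheses (M1 : 1 <= M) (hM : evol_growth U M w).
Local Notation mu := (@lebesgue_measure R).

Let p0 : 0 < p. Proof. by rewrite (lt_le_trans _ p1). Qed.

Section orbit.
Variables (s : R) (x : X).
Hypothesis s0 : 0 <= s.

Let f : R -> X := patch (fun=> 0) `[s, s + 1]%classic (fun tau => U (Num.max tau s) s x).

Let K := M * expR (`|w| * 1).

Let K0 : 0 <= K. Proof. by rewrite mulr_ge0 ?expR_ge0// (le_trans _ M1). Qed.

Lemma orbit_piece_simple_limit : simple_limit (@Rplus R) f.
Proof.
apply: simple_limit_patch; first exact: measurable_itv.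
apply: (simple_limit_sub (@subIsetl _ _ _)); apply: continuous_simple_limit.
by apply: continuous_subspaceT; exact: orbit_continuous.
Qed.

Lemma orbit_piece_Lp_norm_le : (Lp_norm p f <= (K * rnorm x)%:E)%E.
Proof.
have Kx0 : 0 <= K * rnorm x by rewrite mulr_ge0// rnorm_ge0.
have le : (Lp_integral p f <= ((K * rnorm x) `^ p)%:E)%E.
  apply: (@le_trans _ _ (\int[mu]_(t in `[s, (s + 1)%R]) ((K * rnorm x) `^ p)%:E)%E).
    rewrite /Lp_integral integral_mkcond [leRHS]integral_mkcond.
    apply: ge0_ae_le_integral_nomeas.
    - by move=> t _; rewrite patchE; case: ifPn => // _; rewrite lee_fin powR_ge0.
    - by move=> t _; rewrite patchE; case: ifPn => // _; rewrite lee_fin powR_ge0.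
    apply: aeW => t _; rewrite !patchE /f /patch.
    have [/set_mem|ts] := boolP (t \in `[s, s + 1]%classic); last first.
      by case: ifPn => // _; rewrite rnorm0 powR0 ?gt_eqF.
    rewrite /= in_itv/= => /andP[st t1]; case: ifPn => _; rewrite lee_fin ?powR_ge0//.
    apply: ge0_ler_powR; rewrite ?nnegrE ?rnorm_ge0 ?(ltW p0)//.
    rewrite (max_idPl st); apply: evol_growth_loc => //.
    by rewrite lerBlDl.
  rewrite integral_cst//= lebesgue_measure_itv/= lte_fin ltrDl ltr01.
  by rewrite -EFinD addrAC subrr add0r mule1.
rewrite (Lp_normE p1); apply: (@le_trans _ _ (((K * rnorm x) `^ p)%:E `^ p^-1)%E).
  apply: gt0_ler_poweR => //; rewrite ?in_itv/= ?leey ?andbT ?Lp_integral_ge0 ?lee_fin ?powR_ge0//.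
  by rewrite invr_ge0 ltW.
by rewrite poweR_EFin -powRrM mulfV ?gt_eqF// powRr1.
Qed.

Lemma orbit_piece_Lp : Lp_space X p f.
Proof.
split; first exact/simple_limit_strongly_measurable/orbit_piece_simple_limit.
by apply: (le_lt_trans orbit_piece_Lp_norm_le); rewrite ltry.
Qed.

Lemma opG_orbit_piece t : s + 1 <= t -> opG U f t = U t s x.
Proof.
move=> st; have t0 : 0 <= t by rewrite (le_trans _ st)// addr_ge0.
rewrite -[RHS]scale1r -(rmorph1 (@real_complex R)).
transitivity (bochner_integral mu `[0%R, t]%classic
    (patch (fun=> 0) `[s, s + 1]%classic (fun=> U t s x))).
  apply: eq_bochner_integral; apply: aeW => tau _; rewrite /f /patch.
  case: ifPn => [/set_mem|_]; last by rewrite linear0.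
  rewrite /= in_itv/= => /andP[staus taus].
  by rewrite (max_idPl staus) -(evol_comp hU s0 staus (le_trans taus st)).
apply: bochner_integral_eq; [exact: measurable_itv|exact: itv0_fin| |].
  apply: msimple_simple_limit; apply: msimple_patch; [exact: measurable_itv|exact: msimple_cst..].
exact: is_bochner_integral_cst_itv.
Qed.

(** For r in [[t - T, t]] one has r >= s + 1, so Gf(r) = U(r,s)x, and U(t,s)x = U(t,r)U(r,s)x shows
    |Gf(r)| >= |U(t,s)x| / L. This constant lower bound is integrated over a window of length T. *)
Lemma opG_orbit_piece_Lp_norm_ge T L t : 0 < T -> 0 < L -> s + T + 1 <= t ->
  (forall t r y, 0 <= r -> r <= t -> t - r <= T -> rnorm (U t r y) <= L * rnorm y) ->
  ((T `^ p^-1 * (rnorm (U t s x) / L))%:E <= Lp_norm p (opG U f))%E.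
Proof.
move=> T0 L0 st UL; set q := rnorm (U t s x) / L.
have q0 : 0 <= q by rewrite divr_ge0 ?rnorm_ge0// ltW.
have ge : ((T * q `^ p)%:E <= Lp_integral p (opG U f))%E.
  apply: (@le_trans _ _ (\int[mu]_(r in `[(t - T)%R, t]) (q `^ p)%:E)%E).
    rewrite integral_cst//= lebesgue_measure_itv/= lte_fin ltrBlDr ltrDl T0.
    by rewrite -EFinD opprB addrCA subrr addr0 muleC.
  rewrite /Lp_integral integral_mkcond [leRHS]integral_mkcond.
  apply: ge0_ae_le_integral_nomeas.
  - by move=> r _; rewrite patchE; case: ifPn => // _; rewrite lee_fin powR_ge0.
  - by move=> r _; rewrite patchE; case: ifPn => // _; rewrite lee_fin powR_ge0.
  apply: aeW => r _; rewrite !patchE.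
  have [/set_mem|_] := boolP (r \in `[t - T, t]%classic); last first.
    by case: ifPn => // _; rewrite lee_fin powR_ge0.
  rewrite /= in_itv/= => /andP[rT rt].
  have sr : s + 1 <= r by rewrite (le_trans _ rT)// lerBrDr addrAC.
  have sr' : s <= r by rewrite (le_trans _ sr)// lerDl.
  have r0 : 0 <= r by rewrite (le_trans s0).
  rewrite mem_set; last by rewrite /Rplus /= in_itv/= r0.
  rewrite lee_fin; apply: ge0_ler_powR; rewrite ?nnegrE ?rnorm_ge0 ?(ltW p0)//.
  rewrite opG_orbit_piece// /q ler_pdivrMr// mulrC (evol_comp hU s0 sr' rt).
  by apply: UL => //; rewrite lerBlDr addrC -lerBlDr.
rewrite (Lp_normE p1); apply: (@le_trans _ _ ((T * q `^ p)%:E `^ p^-1)%E).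
  rewrite poweR_EFin powRM ?powR_ge0 ?(ltW T0)// -powRrM mulfV ?gt_eqF// powRr1//.
have Tq0 : 0 <= T * q `^ p by rewrite mulr_ge0 ?powR_ge0 ?(ltW T0).
apply: gt0_ler_poweR => //; rewrite ?in_itv/= ?leey ?andbT ?Lp_integral_ge0 ?lee_fin ?powR_ge0//.
by rewrite invr_ge0 ltW.
Qed.

End orbit.

Lemma bounded_Lp_stable :
  bounded_operator_on (Lp_space X p) (@Lp_norm _ _ p) (opG U) -> exponentially_stable U.
Proof.
move=> [_ [C HC]]; pose K := M * expR (`|w| * 1).
have K0 : 0 <= K by rewrite mulr_ge0 ?expR_ge0// (le_trans _ M1).
(* [K] bounds the test function of unit length and does not depend on T. The loss [L] of the lower
   bound becomes the variable constant of the criterion. *)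
apply: (@evol_stability_criterion _ _ _ hU M w (`|C| * K) p^-1 M1 hM).
- by rewrite mulr_ge0.
- by rewrite invr_gt0.
move=> T L T1 L0 UL t s x s0 st; have T0 : 0 < T by rewrite (lt_le_trans _ T1).
have := opG_orbit_piece_Lp_norm_ge x s0 T0 L0 st UL.
set f := patch _ _ _ => ge.
have : ((T `^ p^-1 * (rnorm (U t s x) / L))%:E <= (`|C| * (K * rnorm x))%:E)%E.
  apply: (le_trans ge); apply: (le_trans (HC f (orbit_piece_Lp x s0))).
  apply: (@le_trans _ _ (`|C|%:E * Lp_norm p f)%E).
    by rewrite lee_wpmul2r ?lee_fin ?ler_norm// (Lp_normE p1) poweR_ge0.
  by rewrite EFinM lee_wpmul2l ?lee_fin//; exact: orbit_piece_Lp_norm_le.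
rewrite lee_fin mulrA ler_pdivrMr// => /le_trans; apply.
by rewrite le_eqVlt; apply/orP; left; apply/eqP; ring.
Qed.

End converse_Lp.

Local Close Scope complex_scope.
Local Close Scope classical_set_scope.
Unset Implicit Arguments.

Theorem theorem3p5 (R : realType) (X : completeNormedModType R[i]) (p : R)
    (hp : 1 <= p) (U : R -> R -> {linear X -> X})
    (hU : evolution_family U) (hUb : exponentially_bounded U) :
  [<-> exponentially_stable U;
       bounded_operator_on (Lp_space X p) (@Lp_norm _ _ p) (opG U);
       bounded_operator_on (C0_space X) (@sup_norm _ _) (opG U)].
Proof.
have [M [w [M1 /(exp_boundP _ _ M1) hM]]] := hUb.
have stable_growth : exponentially_stable U ->
    exists N a : R, [/\ 1 <= N, 0 < a & evol_growth U N (- a)].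
  move=> [N [v [N1 v0 /(exp_boundP _ _ N1) hN]]].
  by exists N, (- v); rewrite oppr_gt0 opprK.
tfae.
- by move=> /stable_growth[N [a [N1 a0 hN]]]; exact: stable_bounded_Lp a0 hN.
- move=> /(bounded_Lp_stable hp hU M1 hM)/stable_growth[N [a [N1 a0 hN]]].
  split; first exact: opG_C0 a0 hN.
  by exists (N / a) => f; exact: opG_sup_norm_le.
- exact: bounded_C0_stable hM.
Qed.
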